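(* Let $\mathcal{G}=(X,Y,A,B,\lambda)$ be a regular mirror game (with respect to functions $\xi:X\to Y$, $\eta:Y\to X$), with universal game algebra $\mathcal{U}$ and invalid determining set $\mathcal{N}$. Then $\mathcal{G}$ has a perfect commuting operator strategy if and only if any of the following equivalent conditions is satisfied: (1) There exist a *-representation $\pi:\mathcal{U}\to\mathcal{B}(\mathcal{H})$ and a state $|\psi\rangle\in\mathcal{H}$ satisfying $\pi(\mathcal{L}(\mathcal{N}))|\psi\rangle=\{0\}$. (2) There exist a *-representation $\pi':\mathcal{U}(1)\to\mathcal{B}(\mathcal{H})$ and a tracial state $|\psi\rangle\in\mathcal{H}$ (tracial on $\pi'(\mathcal{U}(1))$) satisfying $\pi'(\mathcal{J}(\mathrm{mir1}))|\psi\rangle=\{0\}$. (3) There exist a *-representation $\pi'':\mathcal{U}(2)\to\mathcal{B}(\mathcal{H})$ and a tracial state $|\phi\rangle\in\mathcal{H}$ (tracial on $\pi''(\mathcal{U}(2))$) satisfying $\pi''(\mathcal{J}(\mathrm{mir2}))|\phi\rangle=\{0\}$. (4) There exists a *-representation $\pi_0'$ of $\mathcal{U}(1)$ mapping into a tracial von Neumann algebra $\mathcal{W}\subseteq\mathcal{B}(\mathcal{H})$ satisfying $\pi_0'(\mathcal{J}(\mathrm{mir1}))=\{0\}$. (5) There exists a *-representation $\pi_0''$ of $\mathcal{U}(2)$ mapping into a tracial von Neumann algebra $\mathcal{W}'\subseteq\mathcal{B}(\mathcal{H})$ satisfying $\pi_0''(\mathcal{J}(\mathrm{mir2}))=\{0\}$.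 (In each condition $\mathcal{H}$ is some Hilbert space.)
   Context: Nonlocal game: $X,Y$ (questions) and $A,B$ (answers) are non-empty finite sets and $\lambda:X\times Y\times A\times B\to\{0,1\}$ is a scoring function; questions $(x,y)$ are drawn from the uniform distribution on $X\times Y$. Mirror game: a nonlocal game $\mathcal{G}=(X,Y,A,B,\lambda)$ for which there are functions $\xi:X\to Y$, $\eta:Y\to X$ (fixed in what follows) with $\lambda(x,\xi(x),a,b)\lambda(x,\xi(x),a',b)=0$ for all $x\in X$, $a\ne a'\in A$, $b\in B$, and $\lambda(\eta(y),y,a,b)\lambda(\eta(y),y,a,b')=0$ for all $y\in Y$, $a\in A$, $b\neq b'\in B$. Regular: with $E_{x,y}^a=\{b\in B:\lambda(x,y,a,b)=1\}$ and $E_{x,y}^b=\{a\in A:\lambda(x,y,a,b)=1\}$, the mirror game is regular if $\bigcup_{a\in A}E_{x,\xi(x)}^a=B$ for all $x\in X$ and $\bigcup_{b\in B}E_{\eta(y),y}^b=A$ for all $y\in Y$. Universal game algebra: $\mathcal{U}=\mathbb{C}\langle e(1)^x_a,\,e(2)^y_b : x\in X,a\in A,y\in Y,b\in B\rangle/\mathscr{I}$, where $\mathscr{I}$ is the two-sided ideal of the free algebra generated by $e(1)^x_ae(2)^y_b-e(2)^y_be(1)^x_a$; $(e(1)^x_a)^2-e(1)^x_a$; $(e(2)^y_b)^2-e(2)^y_b$; $e(1)^x_{a_1}e(1)^x_{a_2}$ ($a_1\ne a_2$); $e(2)^y_{b_1}e(2)^y_{b_2}$ ($b_1\neq b_2$);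 $\sum_{a\in A}e(1)^x_a-1$; $\sum_{b\in B}e(2)^y_b-1$ (for all $x,y,a,b$). The involution $*$ (conjugate-linear, anti-multiplicative) fixes each generator. $\mathcal{U}(1)$ is the subalgebra of $\mathcal{U}$ generated by the $e(1)^x_a$, and $\mathcal{U}(2)$ the subalgebra generated by the $e(2)^y_b$. A *-representation of a unital *-algebra is a unital *-homomorphism into the bounded operators $\mathcal{B}(\mathcal{H})$ on a (possibly infinite-dimensional) Hilbert space $\mathcal{H}$. A state $|\psi\rangle\in\mathcal{H}$ is a unit vector. It is a tracial state on an operator algebra $\mathcal{A}$ acting on $\mathcal{H}$ if $\langle\psi|ab|\psi\rangle=\langle\psi|ba|\psi\rangle$ for all $a,b\in\mathcal{A}$. A linear mapping $\tau:\mathcal{A}\to\mathbb{C}$ on an algebra $\mathcal{A}$ is tracial if $\tau(ab)=\tau(ba)$ for all $a,b\in\mathcal{A}$. A tracial von Neumann algebra is a von Neumann algebra $\mathcal{W}$ together with a tracial linear mapping $\tau:\mathcal{W}\to\mathbb{C}$. Commuting operator strategy: a pair $(\pi,|\psi\rangle)$ with $\pi:\mathcal{U}\to\mathcal{B}(\mathcal{H})$ a *-representation and $|\psi\rangle\in\mathcal{H}$ a state. It is perfect if it wins with certainty, i.e. $\langle\psi|\pi(\Phi_{\mathcal{G}})|\psi\rangle=1$, where $\Phi_{\mathcal{G}}=\frac{1}{|X||Y|}\sum_{x,y,a,b}\lambda(x,y,a,b)\,e(1)^x_ae(2)^y_b$. Invalid determining set: $\mathcal{N}=\{e(1)^x_ae(2)^y_b:\lambda(x,y,a,b)=0\}\subseteq\mathcal{U}$;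 $\mathcal{L}(\mathcal{N})$ is the left ideal of $\mathcal{U}$ generated by $\mathcal{N}$. Define $f^{\eta(y)}_{y,b}=\sum_{a\in A,\ \lambda(\eta(y),y,a,b)=1}e(1)^{\eta(y)}_a\in\mathcal{U}(1)$ and $g^{\xi(x)}_{x,a}=\sum_{b\in B,\ \lambda(x,\xi(x),a,b)=1}e(2)^{\xi(x)}_b\in\mathcal{U}(2)$. Then $\mathcal{J}(\mathrm{mir1})$ is the two-sided ideal of $\mathcal{U}(1)$ generated by $\{e(1)^x_af^{\eta(y)}_{y,b}:\lambda(x,y,a,b)=0\}$, and $\mathcal{J}(\mathrm{mir2})$ is the two-sided ideal of $\mathcal{U}(2)$ generated by $\{e(2)^y_bg^{\xi(x)}_{x,a}:\lambda(x,y,a,b)=0\}$.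
   Formalization: In (4) and (5) the tracial linear mapping τ of the tracial von Neumann algebra is also required to be positive and normalised, τ(1)=1; with merely tracial linear τ, the choice H=0, τ=0 would satisfy (4) and (5) for every game. *)

(* Defs.v *)
From HB Require Import structures.
From mathcomp Require Import all_boot all_order all_algebra.
From mathcomp Require Import sesquilinear generic_quotient finmap.
From mathcomp Require Import all_classical all_reals all_analysis.
From mathcomp Require Import complex.
(* The notations of [monalg] are incompatible with those of MathComp-Analysis. *)
From mathcomp Require Import -(notations) monalg.

Set Implicit Arguments.
Unset Strict Implicit.
Unset Printing Implicit Defensive.

Import Order.TTheory GRing.Theory Num.Theory.
Import numFieldNormedType.Exports.
Local Open Scope classical_set_scope.
Local Open Scope quotient_scope.
Local Open Scope ring_scope.

Section Ideals.
Context {A : pzRingType}.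
Implicit Types D I S : set A.

Definition left_ideal I :=
  [/\ I 0,
      forall u v, I u -> I v -> I (u + v) &
      forall u v, I v -> I (u * v)].

Definition left_ideal_gen S : set A := smallest left_ideal S.

(* Two-sided ideals of a subalgebra [D] of [A]. Closure under scalars and
   opposites follows from [D] being unital. *)
Definition ideal D I :=
  [/\ I `<=` D, I 0,
      forall u v, I u -> I v -> I (u + v),
      forall u v, D u -> I v -> I (u * v) &
      forall u v, I u -> D v -> I (u * v)].

Definition ideal_gen D S : set A := smallest (ideal D) S.

Lemma ideal_gen_ideal S : ideal setT (ideal_gen setT S).
Proof.
split=> //.
- by move=> J [[_ J0 _ _ _] _].
- by move=> u v Iu Iv J JS; case: (JS) => -[_ _ JD _ _] _; apply: JD; [exact: Iu|exact: Iv].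
- by move=> u v _ Iv J JS; case: (JS) => -[_ _ _ JM _] _; apply: JM => //; exact: Iv.
- by move=> u v Iu _ J JS; case: (JS) => -[_ _ _ _ JM] _; apply: JM => //; exact: Iu.
Qed.

Lemma ideal_gen_opp S u : ideal_gen setT S u -> ideal_gen setT S (- u).
Proof.
by have [_ _ _ IM _] := ideal_gen_ideal S; rewrite -mulN1r; apply: IM.
Qed.

End Ideals.

(* The quotient of an algebra by the two-sided ideal generated by [S]. It may be
   zero, so it gets [pzRingType] and [lmodType] structures but no [algType]
   structure; the compatibility of scaling and product is [quot_scalerAl] and
   [quot_scalerAr]. *)
Section Quotient.
Context {C : comNzRingType} {A : algType C} (S : set A).
Let I := ideal_gen setT S.

Definition ideal_equiv (u v : A) : bool := `[< I (u - v) >].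

Lemma ideal_equivP u v : reflect (I (u - v)) (ideal_equiv u v).
Proof. exact: asboolP. Qed.

Lemma ideal_equiv_equiv : equiv_class_of ideal_equiv.
Proof.
have [_ I0 ID _ _] := ideal_gen_ideal S; split.
- by move=> u; apply/ideal_equivP; rewrite subrr.
- by move=> u v; apply/ideal_equivP/ideal_equivP => /ideal_gen_opp; rewrite opprB.
- move=> v u w /ideal_equivP uv /ideal_equivP vw; apply/ideal_equivP.
  by rewrite -[u](subrK v) -addrA; apply: ID.
Qed.

Canonical ideal_equiv_rel := EquivRelPack ideal_equiv_equiv.

Definition quot : Type := {eq_quot ideal_equiv_rel}.

HB.instance Definition _ := Choice.on quot.
HB.instance Definition _ := EqQuotient.on quot.

Definition to_quot : A -> quot := \pi_quot.

Lemma to_quotP u v : to_quot u = to_quot v <-> I (u - v).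
Proof. by split=> [/eqmodP/ideal_equivP //|uv]; apply/eqmodP/ideal_equivP. Qed.

Lemma quotW (P : quot -> Prop) : (forall u, P (to_quot u)) -> forall x, P x.
Proof. by move=> Pu x; rewrite -[x]reprK; apply: Pu. Qed.

Lemma repr_to_quot u : I (repr (to_quot u) - u).
Proof. by apply/to_quotP; rewrite /to_quot reprK. Qed.

Let I0 : I 0. Proof. by have [] := ideal_gen_ideal S. Qed.
Let ID u v : I u -> I v -> I (u + v).
Proof. by have [_ _ + _ _] := ideal_gen_ideal S; apply. Qed.
Let IMl u v : I v -> I (u * v).
Proof. by have [_ _ _ + _] := ideal_gen_ideal S; apply. Qed.
Let IMr u v : I u -> I (u * v).
Proof. by have [_ _ _ _ +] := ideal_gen_ideal S => /[apply]; apply. Qed.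

Definition quot_add (x y : quot) := to_quot (repr x + repr y).
Definition quot_opp (x : quot) := to_quot (- repr x).
Definition quot_mul (x y : quot) := to_quot (repr x * repr y).
Definition quot_scale (c : C) (x : quot) := to_quot (c *: repr x).

Lemma quot_addE u v : quot_add (to_quot u) (to_quot v) = to_quot (u + v).
Proof.
by apply/to_quotP; rewrite opprD addrACA; apply: ID; apply: repr_to_quot.
Qed.

Lemma quot_oppE u : quot_opp (to_quot u) = to_quot (- u).
Proof.
by apply/to_quotP; rewrite -opprD; apply: ideal_gen_opp; apply: repr_to_quot.
Qed.

Lemma quot_mulE u v : quot_mul (to_quot u) (to_quot v) = to_quot (u * v).
Proof.
apply/to_quotP; set u' := repr _; set v' := repr _.
have -> : u' * v' - u * v = (u' - u) * v' + u * (v' - v).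
  by rewrite mulrBl mulrBr addrA subrK.
by apply: ID; [apply: IMr|apply: IMl]; apply: repr_to_quot.
Qed.

Lemma quot_scaleE c u : quot_scale c (to_quot u) = to_quot (c *: u).
Proof.
by apply/to_quotP; rewrite -scalerBr -mulr_algl; apply: IMl; apply: repr_to_quot.
Qed.

Let quotE := (quot_addE, quot_oppE, quot_mulE, quot_scaleE).

Lemma quot_addA : associative quot_add.
Proof. by do 3!elim/quotW=> ?; rewrite !quotE addrA. Qed.
Lemma quot_addC : commutative quot_add.
Proof. by do 2!elim/quotW=> ?; rewrite !quotE addrC. Qed.
Lemma quot_add0 : left_id (to_quot 0) quot_add.
Proof. by elim/quotW=> ?; rewrite !quotE add0r. Qed.
Lemma quot_addN : left_inverse (to_quot 0) quot_opp quot_add.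
Proof. by elim/quotW=> ?; rewrite !quotE addNr. Qed.

HB.instance Definition _ :=
  GRing.isZmodule.Build quot quot_addA quot_addC quot_add0 quot_addN.

Lemma quot_mulA : associative quot_mul.
Proof. by do 3!elim/quotW=> ?; rewrite !quotE mulrA. Qed.
Lemma quot_mul1 : left_id (to_quot 1) quot_mul.
Proof. by elim/quotW=> ?; rewrite !quotE mul1r. Qed.
Lemma quot_1mul : right_id (to_quot 1) quot_mul.
Proof. by elim/quotW=> ?; rewrite !quotE mulr1. Qed.
Lemma quot_mulDl : left_distributive quot_mul +%R.
Proof.
by do 3!elim/quotW=> ?; rewrite /GRing.add /= !quotE mulrDl.
Qed.
Lemma quot_mulDr : right_distributive quot_mul +%R.
Proof.
by do 3!elim/quotW=> ?; rewrite /GRing.add /= !quotE mulrDr.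
Qed.

HB.instance Definition _ := GRing.Zmodule_isPzRing.Build quot
  quot_mulA quot_mul1 quot_1mul quot_mulDl quot_mulDr.

Lemma quot_scaleA a b x : quot_scale a (quot_scale b x) = quot_scale (a * b) x.
Proof. by elim/quotW: x => ?; rewrite !quotE scalerA. Qed.
Lemma quot_scale1 : left_id 1 quot_scale.
Proof. by elim/quotW=> ?; rewrite !quotE scale1r. Qed.
Lemma quot_scaleDr : right_distributive quot_scale +%R.
Proof.
by move=> c; do 2!elim/quotW=> ?; rewrite /GRing.add /= !quotE scalerDr.
Qed.
Lemma quot_scaleDl x : {morph quot_scale^~ x : a b / a + b}.
Proof.
by move=> a b; elim/quotW: x => ?; rewrite /GRing.add /= !quotE -scalerDl.
Qed.

HB.instance Definition _ := GRing.Zmodule_isLmodule.Build C quot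
  quot_scaleA quot_scale1 quot_scaleDr quot_scaleDl.

Lemma to_quotD : {morph to_quot : u v / u + v}.
Proof. by move=> u v; rewrite -quot_addE. Qed.
Lemma to_quotN : {morph to_quot : u / - u}.
Proof. by move=> u; rewrite -quot_oppE. Qed.
Lemma to_quotM : {morph to_quot : u v / u * v}.
Proof. by move=> u v; rewrite -quot_mulE. Qed.
Lemma to_quotZ c : {morph to_quot : u / c *: u}.
Proof. by move=> u; rewrite -quot_scaleE. Qed.

Lemma quot_scalerAl c (x y : quot) : c *: (x * y) = (c *: x) * y.
Proof.
elim/quotW: x => u; elim/quotW: y => v.
by rewrite -to_quotZ -!to_quotM -to_quotZ scalerAl.
Qed.
Lemma quot_scalerAr c (x y : quot) : c *: (x * y) = x * (c *: y).
Proof.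
elim/quotW: x => u; elim/quotW: y => v.
by rewrite -to_quotZ -!to_quotM -to_quotZ scalerAr.
Qed.

End Quotient.

Section FreeAlgebra.
Context {C : numClosedFieldType} {I : choiceType}.

Definition free_alg : Type := malg (fmonom I) C.

HB.instance Definition _ := GRing.Lalgebra.on free_alg.

Definition fgen (i : I) : free_alg := mkmalgU (fmu i) 1.

Lemma free_algE (u : free_alg) : u = \sum_(w <- msupp u) mkmalgU w (mcoeff w u).
Proof. exact: monalgE. Qed.

Lemma free_alg_scaleU c w (d : C) : c *: (mkmalgU w d : free_alg) = mkmalgU w (c * d).
Proof.
by apply/malgP => v; rewrite mcoeffZ !mcoeffU mulrnAr.
Qed.

Lemma free_alg_mulU v w (c d : C) :
  (mkmalgU v c : free_alg) * mkmalgU w d = mkmalgU (fmmul v w) (c * d).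
Proof. exact: fgmulUU. Qed.

Lemma free_alg_scalerAr (c : C) (u v : free_alg) : c *: (u * v) = u * (c *: v).
Proof.
rewrite [u]free_algE [v]free_algE mulr_suml !scaler_sumr mulr_suml.
apply: eq_bigr => i _; rewrite !mulr_sumr scaler_sumr; apply: eq_bigr => j _.
by rewrite free_alg_mulU !free_alg_scaleU free_alg_mulU mulrCA.
Qed.

HB.instance Definition _ :=
  GRing.Lalgebra_isAlgebra.Build C free_alg free_alg_scalerAr.

Definition fm_rev (w : fmonom I) : fmonom I := FMonom (rev w).

Definition free_star (u : free_alg) : free_alg :=
  \sum_(w <- msupp u) mkmalgU (fm_rev w) (mcoeff w u)^*.

Lemma fm_revK : involutive fm_rev.
Proof. by case=> w; rewrite /fm_rev /= revK. Qed.

Lemma mcoeff_free_star u w : mcoeff w (free_star u) = (mcoeff (fm_rev w) u)^*.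
Proof.
rewrite /free_star raddf_sum /=.
under eq_bigr do rewrite mcoeffU.
have [wu|wu] := boolP (fm_rev w \in msupp u).
  rewrite (big_fsetD1 (fm_rev w)) //= fm_revK eqxx mulr1n big1_fset ?addr0 //.
  move=> v; rewrite !inE => /andP[vw _] _.
  by rewrite -(can_eq fm_revK) fm_revK (negbTE vw).
rewrite (mcoeff_outdom wu) conjC0 big1_fset // => v vu _.
case: eqP => // vw; move: wu; rewrite -vw fm_revK vu //.
Qed.

Lemma free_starK : involutive free_star.
Proof.
by move=> u; apply/malgP => w; rewrite !mcoeff_free_star fm_revK conjCK.
Qed.

Lemma free_starD : {morph free_star : u v / u + v}.
Proof.
move=> u v; apply/malgP => w.
by rewrite mcoeffD !mcoeff_free_star mcoeffD rmorphD.
Qed.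

Lemma free_starZ c u : free_star (c *: u) = c^* *: free_star u.
Proof.
apply/malgP => w.
by rewrite mcoeffZ !mcoeff_free_star mcoeffZ rmorphM.
Qed.

Lemma free_starU w c : free_star (mkmalgU w c) = mkmalgU (fm_rev w) c^*.
Proof.
apply/malgP => v; rewrite mcoeff_free_star !mcoeffU rmorphMn /=.
by rewrite -(can_eq fm_revK) fm_revK.
Qed.

Lemma free_star_gen i : free_star (fgen i) = fgen i.
Proof. by rewrite free_starU conjC1 /fgen /fm_rev /fmu !fmE. Qed.

Lemma free_star0 : free_star 0 = 0.
Proof. by rewrite -[in LHS](scale0r 0) free_starZ conjC0 scale0r. Qed.

Lemma free_starN u : free_star (- u) = - free_star u.
Proof. by rewrite -scaleN1r free_starZ rmorphN1 scaleN1r. Qed.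

Lemma free_starM u v : free_star (u * v) = free_star v * free_star u.
Proof.
have sumE := big_morph free_star free_starD free_star0.
rewrite [u]free_algE [v]free_algE mulr_suml !sumE mulr_sumr.
apply: eq_bigr => i _; rewrite mulr_sumr sumE mulr_suml; apply: eq_bigr => j _.
rewrite free_alg_mulU !free_starU free_alg_mulU rmorphM mulrC; congr mkmalgU.
by apply: val_inj; rewrite /= /fmmul !fmE /= rev_cat.
Qed.

Lemma free_star1 : free_star 1 = 1.
Proof. by rewrite -[LHS]mulr1 -[1 in X in _ * X]free_starK -free_starM mulr1 free_starK. Qed.

End FreeAlgebra.
Arguments free_alg : clear implicits.

Section GameAlgebra.
Context (C : numClosedFieldType) (X Y A B : finType).

Definition gens : choiceType := (X * A + Y * B)%type.
Local Notation F := (free_alg C gens).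

Definition fe1 (x : X) (a : A) : F := fgen (inl (x, a) : gens).
Definition fe2 (y : Y) (b : B) : F := fgen (inr (y, b) : gens).

Inductive game_relation : set F :=
| game_comm x a y b : game_relation (fe1 x a * fe2 y b - fe2 y b * fe1 x a)
| game_idem1 x a : game_relation (fe1 x a ^+ 2 - fe1 x a)
| game_idem2 y b : game_relation (fe2 y b ^+ 2 - fe2 y b)
| game_orth1 x a1 a2 : a1 != a2 -> game_relation (fe1 x a1 * fe1 x a2)
| game_orth2 y b1 b2 : b1 != b2 -> game_relation (fe2 y b1 * fe2 y b2)
| game_sum1 x : game_relation (\sum_a fe1 x a - 1)
| game_sum2 y : game_relation (\sum_b fe2 y b - 1).

Definition game_alg : Type := quot game_relation.
HB.instance Definition _ := GRing.PzRing.on game_alg.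
HB.instance Definition _ := GRing.Lmodule.on game_alg.

Definition e1 (x : X) (a : A) : game_alg := to_quot _ (fe1 x a).
Definition e2 (y : Y) (b : B) : game_alg := to_quot _ (fe2 y b).

Definition star (u : game_alg) : game_alg := to_quot _ (free_star (repr u)).

Lemma free_star_relation r :
  game_relation r -> ideal_gen setT game_relation (free_star r).
Proof.
have starsum := big_morph free_star (@free_starD C gens) free_star0.
case=> [x a y b|x a|y b|x a1 a2 n|y b1 b2 n|x|y];
  rewrite ?(free_starD, free_starN, expr2, free_starM, starsum, free_star_gen, free_star1).
- rewrite -opprB; apply: ideal_gen_opp; apply: sub_gen_smallest.
  exact: game_comm.
- by apply: sub_gen_smallest; rewrite -expr2; apply: game_idem1.
- by apply: sub_gen_smallest; rewrite -expr2; apply: game_idem2.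
- by apply: sub_gen_smallest; apply: game_orth1; rewrite eq_sym.
- by apply: sub_gen_smallest; apply: game_orth2; rewrite eq_sym.
- under eq_bigr do rewrite free_star_gen.
  by apply: sub_gen_smallest; apply: game_sum1.
- under eq_bigr do rewrite free_star_gen.
  by apply: sub_gen_smallest; apply: game_sum2.
Qed.

Lemma free_star_ideal r : ideal_gen setT game_relation r ->
  ideal_gen setT game_relation (free_star r).
Proof.
have [_ I0 ID Il Ir] := ideal_gen_ideal game_relation.
move: r; apply: smallest_sub; last exact: free_star_relation.
split=> //=; first by rewrite free_star0.
- by move=> v w; rewrite free_starD; apply: ID.
- by move=> v w _ Iw; rewrite free_starM; apply: Ir.
- by move=> v w Iv _; rewrite free_starM; apply: Il.
Qed.

Lemma game_algW (P : game_alg -> Prop) :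
  (forall u, P (to_quot game_relation u)) -> forall x, P x.
Proof. exact: quotW. Qed.

Lemma star_to_quot u : star (to_quot _ u) = to_quot _ (free_star u).
Proof.
apply/to_quotP; rewrite -free_starN -free_starD.
by apply: free_star_ideal; apply: repr_to_quot.
Qed.

Lemma star_e1 x a : star (e1 x a) = e1 x a.
Proof. by rewrite star_to_quot free_star_gen. Qed.

Lemma star_e2 y b : star (e2 y b) = e2 y b.
Proof. by rewrite star_to_quot free_star_gen. Qed.

Lemma starK : involutive star.
Proof. by elim/game_algW=> u; rewrite !star_to_quot free_starK. Qed.

Lemma starD : {morph star : u v / u + v}.
Proof.
elim/game_algW=> u; elim/game_algW=> v.
by rewrite -[LHS]/(star (to_quot _ u + to_quot _ v)) -to_quotD
  !star_to_quot free_starD to_quotD.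
Qed.

Lemma starZ (c : C) (u : game_alg) : star (c *: u) = c^* *: star u.
Proof.
elim/game_algW: u => u.
by rewrite -[LHS]/(star (c *: to_quot _ u)) -to_quotZ !star_to_quot free_starZ to_quotZ.
Qed.

Lemma starM (u v : game_alg) : star (u * v) = star v * star u.
Proof.
elim/game_algW: u => u; elim/game_algW: v => v.
by rewrite -[LHS]/(star (to_quot _ u * to_quot _ v)) -to_quotM
  !star_to_quot free_starM to_quotM.
Qed.

Definition subalgebra (D : set game_alg) :=
  [/\ D 1,
      forall (c : C) u v, D u -> D v -> D (c *: u + v) &
      forall u v, D u -> D v -> D (u * v)].

Definition subalgebra_gen (S : set game_alg) : set game_alg :=
  smallest subalgebra S.

Definition game_alg1 : set game_alg :=
  subalgebra_gen [set u | exists x a, u = e1 x a].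
Definition game_alg2 : set game_alg :=
  subalgebra_gen [set u | exists y b, u = e2 y b].

End GameAlgebra.
Arguments e1 {C X Y A B}.
Arguments e2 {C X Y A B}.
Arguments game_alg1 {C X Y A B}.
Arguments game_alg2 {C X Y A B}.

HB.mixin Record isHilbert (R : realType) H
    of CompleteNormedModule R[i] H := {
  hdot : {dot H for @Num.conj R[i]};
  hdot_norm : forall x : H, hdot x x = `|x| ^+ 2
}.

#[short(type="hilbertType")]
HB.structure Definition Hilbert (R : realType) :=
  { H of CompleteNormedModule R[i] H & isHilbert R H }.

Section BoundedOperators.
Context {R : realType}.

Definition bounded_op (H : hilbertType R) (f : H -> H) :=
  linear f /\ continuous f.

Record bop (H : hilbertType R) :=
  Bop { bop_fun :> H -> H; bop_bounded : bounded_op bop_fun }.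

Context {H : hilbertType R}.

HB.instance Definition _ := gen_eqMixin (bop H).
HB.instance Definition _ := gen_choiceMixin (bop H).

Lemma bop_linear (T : bop H) : linear T.
Proof. by have [] := bop_bounded T. Qed.

Lemma bop_continuous (T : bop H) : continuous T.
Proof. by have [] := bop_bounded T. Qed.

Lemma bopP (S T : bop H) : S =1 T -> S = T.
Proof.
case: S T => [f fB] [g gB] /= /funext fg; move: fB gB; rewrite fg => fB gB.
by congr Bop; apply: Prop_irrelevance.
Qed.

Lemma bop_zero_proof : bounded_op (fun _ : H => 0 : H).
Proof.
split=> [c x y|x]; first by rewrite scaler0 addr0.
exact: cst_continuous.
Qed.

Lemma bop_opp_proof (T : bop H) : bounded_op (fun x => - T x).
Proof.
split=> [c x y|x].
  by rewrite bop_linear opprD scalerN.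
by apply: continuousN; apply: bop_continuous.
Qed.

Lemma bop_add_proof (S T : bop H) : bounded_op (fun x => S x + T x).
Proof.
split=> [c x y|x].
  by rewrite !bop_linear scalerDr addrACA.
by apply: continuousD; apply: bop_continuous.
Qed.

Lemma bop_scale_proof (c : R[i]) (T : bop H) :
  bounded_op (fun x => c *: T x).
Proof.
split=> [d x y|x].
  by rewrite !bop_linear scalerDr !scalerA mulrC.
by apply: continuousZr; apply: bop_continuous.
Qed.

Lemma bop_one_proof : bounded_op (fun x : H => x).
Proof. by split=> // x; apply: cvg_id. Qed.

Lemma bop_mul_proof (S T : bop H) : bounded_op (fun x => S (T x)).
Proof.
split=> [d x y|x]; first by rewrite !bop_linear.
by apply: (continuous_comp (f := T)); apply: bop_continuous.
Qed.

Definition bop_zero := Bop bop_zero_proof.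
Definition bop_opp T := Bop (bop_opp_proof T).
Definition bop_add S T := Bop (bop_add_proof S T).
Definition bop_scale c T := Bop (bop_scale_proof c T).
Definition bop_one := Bop bop_one_proof.
Definition bop_mul S T := Bop (bop_mul_proof S T).

Lemma bop_addA : associative bop_add.
Proof. by move=> S T U; apply: bopP => x /=; rewrite addrA. Qed.
Lemma bop_addC : commutative bop_add.
Proof. by move=> S T; apply: bopP => x /=; rewrite addrC. Qed.
Lemma bop_add0 : left_id bop_zero bop_add.
Proof. by move=> T; apply: bopP => x /=; rewrite add0r. Qed.
Lemma bop_addN : left_inverse bop_zero bop_opp bop_add.
Proof. by move=> T; apply: bopP => x /=; rewrite addNr. Qed.

HB.instance Definition _ :=
  GRing.isZmodule.Build (bop H) bop_addA bop_addC bop_add0 bop_addN.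

Lemma bop_mulA : associative bop_mul.
Proof. by move=> S T U; apply: bopP. Qed.
Lemma bop_mul1 : left_id bop_one bop_mul.
Proof. by move=> T; apply: bopP. Qed.
Lemma bop_1mul : right_id bop_one bop_mul.
Proof. by move=> T; apply: bopP. Qed.
Lemma bop_mulDl : left_distributive bop_mul +%R.
Proof. by move=> S T U; apply: bopP. Qed.
Lemma bop_mulDr : right_distributive bop_mul +%R.
Proof.
move=> S T U; apply: bopP => x /=.
by have := bop_linear S 1 (T x) (U x); rewrite !scale1r.
Qed.

HB.instance Definition _ := GRing.Zmodule_isPzRing.Build (bop H)
  bop_mulA bop_mul1 bop_1mul bop_mulDl bop_mulDr.

Lemma bop_scaleA a b T : bop_scale a (bop_scale b T) = bop_scale (a * b) T.
Proof. by apply: bopP => x /=; rewrite scalerA. Qed.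
Lemma bop_scale1 : left_id 1 bop_scale.
Proof. by move=> T; apply: bopP => x /=; rewrite scale1r. Qed.
Lemma bop_scaleDr : right_distributive bop_scale +%R.
Proof. by move=> c S T; apply: bopP => x /=; rewrite scalerDr. Qed.
Lemma bop_scaleDl T : {morph bop_scale^~ T : a b / a + b}.
Proof. by move=> a b; apply: bopP => x /=; rewrite scalerDl. Qed.

HB.instance Definition _ := GRing.Zmodule_isLmodule.Build R[i] (bop H)
  bop_scaleA bop_scale1 bop_scaleDr bop_scaleDl.

Definition is_adjoint (T T' : bop H) :=
  forall x y : H, hdot (T x) y = hdot x (T' y).

(* [hdot] is linear in its first argument, so this is <psi|T|psi>. *)
Definition expect (T : bop H) (psi : H) : R[i] := hdot (T psi) psi.

Definition is_state (psi : H) := `|psi| = 1.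

Definition tracial_state (W : set (bop H)) (psi : H) :=
  is_state psi /\
  forall S T, W S -> W T -> expect (S * T) psi = expect (T * S) psi.

(* The weak operator topology: the initial topology of the matrix
   coefficients T |-> <T x, y>. *)
Definition matrix_coef (T : bop H) : {ptws H * H -> R[i]^o} :=
  fun p => hdot (T p.1) p.2.

Definition wot : topologicalType := initial_topology matrix_coef.

Definition von_neumann_algebra (W : set (bop H)) :=
  [/\ W 1,
      forall (c : R[i]) S T, W S -> W T -> W (c *: S + T),
      forall S T, W S -> W T -> W (S * T),
      forall T T', W T -> is_adjoint T T' -> W T' &
      @closed wot W].

(* Only the values of [tau] on [W] are relevant. *)
Definition tracial (W : set (bop H)) (tau : bop H -> R[i]) :=
  forall S T, W S -> W T -> tau (S * T) = tau (T * S).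

Definition linear_functional (W : set (bop H)) (tau : bop H -> R[i]) :=
  forall (c : R[i]) S T, W S -> W T -> tau (c *: S + T) = c * tau S + tau T.

Definition positive_functional (W : set (bop H)) (tau : bop H -> R[i]) :=
  forall T T', W T -> is_adjoint T T' -> 0 <= tau (T' * T).

(* The trace is normalised and positive: the zero functional is tracial on any
   von Neumann algebra. *)
Definition tracial_von_neumann_algebra
    (W : set (bop H)) (tau : bop H -> R[i]) :=
  [/\ von_neumann_algebra W, linear_functional W tau, tracial W tau,
      positive_functional W tau & tau 1 = 1].

End BoundedOperators.

Section Games.
Context (R : realType) {X Y A B : finType}.
Local Notation U := (game_alg R[i] X Y A B).

(* A *-representation of the unital *-subalgebra [D] of U. As with
   {morphism D >-> rT}, [pi] is a total function of which only the values
   on [D] are relevant. *)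
Definition star_rep {H : hilbertType R} (D : set U) (pi : U -> bop H) :=
  [/\ pi 1 = 1,
      forall (c : R[i]) u v, D u -> D v -> pi (c *: u + v) = c *: pi u + pi v,
      forall u v, D u -> D v -> pi (u * v) = pi u * pi v &
      forall u, D u -> is_adjoint (pi u) (pi (star u))].

Variable lam : X -> Y -> A -> B -> bool.

Definition answersB (x : X) (y : Y) (a : A) : {set B} := [set b | lam x y a b]%SET.
Definition answersA (x : X) (y : Y) (b : B) : {set A} := [set a | lam x y a b]%SET.

Definition mirror_game (xi : X -> Y) (eta : Y -> X) :=
  (forall x a a' b, a != a' -> ~~ (lam x (xi x) a b && lam x (xi x) a' b)) /\
  (forall y a b b', b != b' -> ~~ (lam (eta y) y a b && lam (eta y) y a b')).

Definition regular_game (xi : X -> Y) (eta : Y -> X) :=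
  (forall x, (\bigcup_(a : A) answersB x (xi x) a)%SET = [set: B]%SET) /\
  (forall y, (\bigcup_(b : B) answersA (eta y) y b)%SET = [set: A]%SET).

Definition game_poly : U :=
  (#|X|%:R * #|Y|%:R)^-1 *:
    \sum_x \sum_y \sum_a \sum_b (lam x y a b)%:R *: (e1 x a * e2 y b).

Definition perfect_commuting_strategy :=
  exists (H : hilbertType R) (pi : U -> bop H) (psi : H),
    [/\ star_rep setT pi, is_state psi & expect (pi game_poly) psi = 1].

Definition invalid_set : set U :=
  [set u | exists x y a b, ~~ lam x y a b /\ u = e1 x a * e2 y b].

Definition mirror_f (eta : Y -> X) (y : Y) (b : B) : U :=
  \sum_(a | lam (eta y) y a b) e1 (eta y) a.

Definition mirror_g (xi : X -> Y) (x : X) (a : A) : U :=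
  \sum_(b | lam x (xi x) a b) e2 (xi x) b.

Definition mir1 (eta : Y -> X) : set U :=
  ideal_gen game_alg1
    [set u | exists x y a b,
       ~~ lam x y a b /\ u = e1 x a * mirror_f eta y b].

Definition mir2 (xi : X -> Y) : set U :=
  ideal_gen game_alg2
    [set u | exists x y a b,
       ~~ lam x y a b /\ u = e2 y b * mirror_g xi x a].

End Games.

(* Main.v *)
(* Everything factors through one tracial datum: a normalized positive trace phi
   on a *-algebra together with two families p, q of projective measurements in
   it, of which p is indexed by X, A and q by Y, B, such that phi(p^x_a q^y_b) = 0
   whenever (x, y, a, b) is losing.

   Each condition yields such a datum. A trace on U(1) gives p = e(1) and q = f,
   and a trace on U(2) gives q = e(2) and p = g; f and g are projective
   measurements because the game is regular. Under (1), e(1)^x_a psi = g psi and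
   e(2)^y_b psi = f psi, so that e(1)^x_a can be replaced by an element of the
   commutant of U(1), and psi is therefore tracial on U(1).

   Conversely, let the algebra act on the GNS space of phi. Left multiplication
   by p and right multiplication by q is a perfect strategy. Left multiplication
   by p alone is a representation of U(1) that kills J(mir1), because p f and p q
   differ by a null element, and the null elements form a two-sided ideal; it
   takes values in the commutant of all right multiplications. That commutant is
   visibly weakly closed, and an approximation argument shows that the cyclic
   vector is tracial on it, so neither the bicommutant theorem nor the existence
   of adjoints is needed. *)
Require Import Defs.
From HB Require Import structures.
From mathcomp Require Import all_boot all_order all_algebra.
From mathcomp Require Import all_classical all_reals all_analysis.
From mathcomp Require Import sesquilinear finmap complex ring.
From mathcomp Require Import -(notations) monalg.

Set Implicit Arguments.
Unset Strict Implicit.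
Unset Printing Implicit Defensive.

Import Order.TTheory GRing.Theory Num.Theory.
Import numFieldNormedType.Exports.
Local Open Scope classical_set_scope.
Local Open Scope ring_scope.

Section ComplexSequences.
Context {R : realType}.
Local Notation C := R[i].
Implicit Types (e l : C) (s : nat -> C).

Lemma pos_inv_lt e : 0 < e -> exists n, n.+1%:R^-1 < e.
Proof.
move=> e0; have eR : (complex.Re e)%:C%C = e by rewrite RRe_real// gtr0_real.
have /ltr_add_invr[n] : 0 < complex.Re e by rewrite -ltcR eR.
rewrite add0r => ne; exists n.
by rewrite -eR -[n.+1%:R](rmorph_nat (real_complex R)) -fmorphV ltcR.
Qed.

(* The topology of the library lives on the alias [C^o] of [C]; plain epsilon-N
   convergence avoids the alias. *)
Definition clim s l := forall e, 0 < e ->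
  exists N, forall n, (N <= n)%N -> `|l - s n| < e.

Lemma le_all_pos_eq0 (x : C) : 0 <= x -> (forall e, 0 < e -> x <= e) -> x = 0.
Proof.
rewrite le_eqVlt => /orP[/eqP //|x0] xe.
have x2 : x / 2 < x by rewrite ltr_pdivrMr// ltr_pMr// ltr1n.
by have := le_lt_trans (xe _ (divr_gt0 x0 (ltr0n C 2))) x2; rewrite ltxx.
Qed.

Lemma clim_ge0 s l : (forall n, 0 <= s n) -> clim s l -> 0 <= l.
Proof.
move=> s0 sl; suff /eqP : `|l - `|l| | = 0.
  by rewrite normr_eq0 subr_eq0 => /eqP ->.
apply: le_all_pos_eq0 => // e e0.
have [N /(_ _ (leqnn _)) lN] := sl _ (divr_gt0 e0 (ltr0n C 2)).
have -> : l - `|l| = (l - s N) + (s N - `|l|) by rewrite addrA subrK.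
apply: le_trans (ler_normD _ _) _; rewrite [e]splitr lerD ?(ltW lN)//.
by rewrite -{1}(ger0_norm (s0 N)) (le_trans (ler_dist_dist _ _))// distrC ltW.
Qed.

Lemma clim_norm_le s l (c : C) :
  (exists N, forall n, (N <= n)%N -> `|s n| <= c) -> clim s l -> `|l| <= c.
Proof.
move=> [N sc] sl.
have c0 : 0 <= c by apply: le_trans (sc N (leqnn _)).
have [//|cl] := real_leP (normr_real l) (ger0_real c0).
have /sl[M /(_ (maxn M N) (leq_maxl _ _)) lM] : 0 < `|l| - c by rewrite subr_gt0.
have := sc _ (leq_maxr M N) => sc'.
have /le_lt_trans/(_ lM) := lerB_dist l (s (maxn M N)).
by rewrite ltrD2l ltrN2 => /lt_le_trans/(_ sc'); rewrite ltxx.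
Qed.

Lemma clim_conjC s l : clim s l -> clim (fun n => (s n)^*) l^*.
Proof.
move=> sl e /sl[N Ns]; exists N => n /Ns.
by rewrite -rmorphB norm_conjC.
Qed.

Lemma clim_cst l : clim (fun _ => l) l.
Proof. by move=> e e0; exists 0 => n _; rewrite subrr normr0. Qed.

Lemma clim_linear (c : C) s s' l l' : clim s l -> clim s' l' ->
  clim (fun n => c * s n + s' n) (c * l + l').
Proof.
move=> sl s'l e e0; pose c1 : C := `|c| + 1.
have c1_gt0 : 0 < c1 by rewrite ltr_wpDl.
have [N Ns] := sl _ (divr_gt0 (divr_gt0 e0 (ltr0n C 2)) c1_gt0).
have [M Ms] := s'l _ (divr_gt0 e0 (ltr0n C 2)).
exists (maxn N M) => n; rewrite geq_max => /andP[/Ns Nn /Ms Mn].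
rewrite opprD addrACA -mulrBr; apply: le_lt_trans (ler_normD _ _) _.
rewrite [e]splitr ler_ltD// normrM.
move: Nn; rewrite ltr_pdivlMr// mulrC => /ltW; apply: le_trans.
by rewrite ler_wpM2r// lerDl.
Qed.

Lemma clim_dist0 s s' l : (forall e, 0 < e -> exists N, forall n, (N <= n)%N ->
    `|s' n - s n| <= e) -> clim s' l -> clim s l.
Proof.
move=> ss' s'l e e0.
have e2 : 0 < e / 2 by apply: divr_gt0.
have [N Ns] := ss' _ e2; have [M Ms] := s'l _ e2.
exists (maxn N M) => n; rewrite geq_max => /andP[/Ns n1 /Ms n2].
have -> : l - s n = (l - s' n) + (s' n - s n) by rewrite addrA subrK.
by apply: le_lt_trans (ler_normD _ _) _; rewrite [e]splitr ltr_leD.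
Qed.

Lemma real_cauchy_cvg (r : nat -> R) :
  (forall d : R, 0 < d -> exists N, forall n m, (N <= n)%N -> (N <= m)%N ->
     `|r n - r m| < d) -> cvg (r @ \oo).
Proof.
move=> rC; apply: R_complete; apply/cauchy_exP => d /rC[N Nr].
by exists (r N), N => // n Nn; apply: Nr.
Qed.

Lemma complex_cauchy_cvg s :
  (forall e, 0 < e -> exists N, forall n m, (N <= n)%N -> (N <= m)%N ->
     `|s n - s m| < e) -> exists l, clim s l.
Proof.
move=> sC.
have part (f : C -> R) : (forall z z', f (z - z') = f z - f z') ->
    (forall z, `|f z|%:C%C <= `|z|) ->
    exists a, forall d : R, 0 < d -> exists N, forall n, (N <= n)%N -> `|a - f (s n)| < d.
  move=> fB fle; have /cvg_ex[a fa] : cvg ((f \o s) @ \oo).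
    apply: real_cauchy_cvg => d d0; have /sC[N Ns] : 0 < d%:C%C by rewrite ltcR.
    exists N => n m Nn Nm; rewrite -ltcR -fB.
    exact: le_lt_trans (fle _) (Ns _ _ Nn Nm).
  exists a => d d0.
  by move/cvgrPdist_lt : fa => /(_ _ d0)[N _ Na]; exists N => n; apply: Na.
have [|a sa] := part (@complex.Re R) _ (@normc_ge_Re R); first by case=> ? ? [].
have [||b sb] := part (@complex.Im R); first by case=> ? ? [].
  move=> z; rewrite -normrN -ReiNIm (le_trans (normc_ge_Re _))// normrM.
  by rewrite (_ : `|'i%C| = 1) ?mulr1// normc_def /= expr0n add0r expr1n sqrtr1.
exists (a +i* b)%C => e e0.
have eR : (complex.Re e)%:C%C = e by rewrite RRe_real// gtr0_real.
have e2 : 0 < complex.Re e / 2 by rewrite divr_gt0// -ltcR eR.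
have [N Na] := sa _ e2; have [M Mb] := sb _ e2; exists (maxn N M) => n.
rewrite geq_max => /andP[/Na Han /Mb Hbn].
have -> : (a +i* b)%C - s n =
    (a - complex.Re (s n))%:C%C + 'i%C * (b - complex.Im (s n))%:C%C.
  by rewrite [LHS]complexE; case: (s n).
apply: le_lt_trans (ler_normD _ _) _.
rewrite normrM (_ : `|'i%C| = 1) ?mul1r; last first.
  by rewrite normc_def /= expr0n add0r expr1n sqrtr1.
by rewrite !normc_def /= !expr0n !addr0 !sqrtr_sqr -rmorphD -eR ltcR (splitr (complex.Re e)) ltrD.
Qed.

Lemma clim_unique s l l' : clim s l -> clim s l' -> l = l'.
Proof.
move=> sl sl'; apply/eqP; rewrite -subr_eq0 -normr_eq0; apply/eqP.
have := clim_norm_le _ (clim_linear (-1) sl' sl).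
move=> dl; apply: le_all_pos_eq0 => // e e0; rewrite addrC -mulN1r.
by apply: dl; exists 0 => n _; rewrite mulN1r addNr normr0 ltW.
Qed.

End ComplexSequences.

(** * Positive semidefinite forms and their Hilbert space completion *)

Record semi_dot (R : realType) (V : lmodType R[i]) := SemiDot {
  sdot :> V -> V -> R[i];
  sdot_linear : forall (c : R[i]) u v w, sdot (c *: u + v) w = c * sdot u w + sdot v w;
  sdotC : forall u v, sdot u v = (sdot v u)^*;
  sdot_ge0 : forall u, 0 <= sdot u u
}.

Section SemiDot.
Context {R : realType} {V : lmodType R[i]} (h : semi_dot V).
Local Notation C := R[i].
Implicit Types (u v w : V) (c : C).

Lemma sdotDl u v w : h (u + v) w = h u w + h v w.
Proof. by rewrite -[u]scale1r sdot_linear mul1r scale1r. Qed.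

Lemma sdot0l w : h 0 w = 0.
Proof. by apply: (addIr (h 0 w)); rewrite -sdotDl !add0r. Qed.

Lemma sdotZl c u w : h (c *: u) w = c * h u w.
Proof. by rewrite -[c *: u]addr0 sdot_linear sdot0l addr0. Qed.

Lemma sdotNl u w : h (- u) w = - h u w.
Proof. by rewrite -scaleN1r sdotZl mulN1r. Qed.

Lemma sdotBl u v w : h (u - v) w = h u w - h v w.
Proof. by rewrite sdotDl sdotNl. Qed.

Lemma sdotDr u v w : h u (v + w) = h u v + h u w.
Proof. by rewrite sdotC sdotDl rmorphD /= -!sdotC. Qed.

Lemma sdotNr u v : h u (- v) = - h u v.
Proof. by rewrite sdotC sdotNl rmorphN /= -sdotC. Qed.

Lemma sdotBr u v w : h u (v - w) = h u v - h u w.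
Proof. by rewrite sdotDr sdotNr. Qed.

Lemma sdotZr c u v : h u (c *: v) = c^* * h u v.
Proof. by rewrite sdotC sdotZl rmorphM /= -sdotC. Qed.

Lemma sdot0r u : h u 0 = 0.
Proof. by rewrite sdotC sdot0l conjC0. Qed.

Definition snorm u : C := sqrtC (h u u).

Lemma snorm_ge0 u : 0 <= snorm u.
Proof. by rewrite sqrtC_ge0 sdot_ge0. Qed.

Lemma snorm_sqr u : snorm u ^+ 2 = h u u.
Proof. exact: sqrtCK. Qed.

Lemma sdot_expand c u v :
  h (u - c *: v) (u - c *: v) =
  h u u - (c^* * h u v + (c^* * h u v)^*) + `|c| ^+ 2 * h v v.
Proof.
rewrite sdotBl !sdotBr !sdotZl !sdotZr rmorphM /= conjCK normCK [h v u]sdotC.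
ring.
Qed.

Lemma sdot_null u v : h v v = 0 -> h u v = 0.
Proof.
move=> v0; apply/eqP; case: eqP => // /eqP uv0.
pose m := `|h u v| ^+ 2; have m0 : 0 < m by rewrite exprn_gt0// normr_gt0.
pose t : C := (h u u + 1) / m.
have tR : t^* = t by apply/CrealP; rewrite ger0_real// divr_ge0 ?addr_ge0 ?sdot_ge0// ltW.
have := sdot_ge0 h (u - (t * h u v) *: v); rewrite sdot_expand v0 mulr0 addr0.
have -> : (t * h u v)^* * h u v = h u u + 1.
  by rewrite rmorphM /= tR -mulrA [_^* * _]mulrC -normCK divfK ?gt_eqF.
rewrite rmorphD /= -sdotC conjC1.
have -> : h u u - (h u u + 1 + (h u u + 1)) = - (h u u + 2) by ring.
rewrite oppr_ge0 => le0.
have : 0 < h u u + 2 by rewrite ltr_wpDl// sdot_ge0.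
by move=> /lt_geF; rewrite le0.
Qed.

Lemma sdot_CS u v : `|h u v| <= snorm u * snorm v.
Proof.
have [v0|v0] := eqVneq (h v v) 0.
  by rewrite sdot_null// normr0 mulr_ge0 ?snorm_ge0.
have vgt0 : 0 < h v v by rewrite lt_def v0 sdot_ge0.
rewrite -(@ler_pXn2r _ 2)// ?nnegrE ?mulr_ge0 ?snorm_ge0// exprMn !snorm_sqr.
rewrite -ler_pdivrMr// -subr_ge0.
have vR : (h v v)^* = h v v by rewrite -sdotC.
have := sdot_ge0 h (u - (h u v / h v v) *: v); rewrite sdot_expand.
rewrite !normCK !rmorphM /= !fmorphV /= ?rmorphM /= ?fmorphV /= ?conjCK ?vR.
by move=> /le_trans; apply; rewrite le_eqVlt; apply/orP; left; apply/eqP; field.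
Qed.

Lemma snormD u v : snorm (u + v) <= snorm u + snorm v.
Proof.
rewrite -(@ler_pXn2r _ 2)// ?nnegrE ?addr_ge0 ?snorm_ge0//.
rewrite sqrrD !snorm_sqr sdotDl !sdotDr addrA lerD2r -addrA lerD2l.
rewrite [h v u]sdotC mulr2n.
have sR : h u v + (h u v)^* \is Num.real by rewrite CrealE rmorphD /= conjCK addrC.
apply: le_trans (real_ler_norm sR) _; apply: le_trans (ler_normD _ _) _.
by rewrite norm_conjC lerD// sdot_CS.
Qed.

Lemma snormZ c u : snorm (c *: u) = `|c| * snorm u.
Proof.
rewrite /snorm sdotZl sdotZr mulrA -normCK sqrtCM ?nnegrE ?exprn_ge0 ?sdot_ge0//.
by rewrite sqrCK.
Qed.

Lemma snormN u : snorm (- u) = snorm u.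
Proof. by rewrite -scaleN1r snormZ normrN1 mul1r. Qed.

End SemiDot.

Section Completion.
Context {R : realType} {V : lmodType R[i]} (h : semi_dot V).
Local Notation C := R[i].
Implicit Types (u v : nat -> V) (F G : V -> C) (e : C).

Definition vcauchy u := forall e, 0 < e -> exists N, forall n m,
  (N <= n)%N -> (N <= m)%N -> snorm h (u n - u m) < e.

Definition represents u F :=
  vcauchy u /\ forall w, clim (fun n => h (u n) w) (F w).

Lemma vcauchy_bounded u : vcauchy u ->
  exists2 K : C, 0 < K & exists N, forall n, (N <= n)%N -> snorm h (u n) <= K.
Proof.
move=> /(_ 1 ltr01)[N uN]; exists (1 + snorm h (u N)).
  by rewrite ltr_wpDr ?snorm_ge0.
exists N => n Nn; rewrite -[u n](subrK (u N)).
by rewrite (le_trans (snormD _ _ _))// lerD2r ltW// uN.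
Qed.

Lemma vcauchy_linear (c : C) u v :
  vcauchy u -> vcauchy v -> vcauchy (fun n => c *: u n + v n).
Proof.
move=> uC vC e e0; pose c1 : C := `|c| + 1.
have c1_gt0 : 0 < c1 by rewrite ltr_wpDl.
have [N uN] := uC _ (divr_gt0 (divr_gt0 e0 (ltr0n C 2)) c1_gt0).
have [M vM] := vC _ (divr_gt0 e0 (ltr0n C 2)).
exists (maxn N M) => n m; rewrite !geq_max => /andP[Nn Mn] /andP[Nm Mm].
rewrite opprD addrACA -scalerBr; apply: le_lt_trans (snormD _ _ _) _.
rewrite [e]splitr ltr_leD ?(ltW (vM _ _ Mn Mm))// snormZ.
have := uN _ _ Nn Nm; rewrite ltr_pdivlMr// mulrC; apply: le_lt_trans.
by rewrite ler_wpM2r ?snorm_ge0// lerDl.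
Qed.

Lemma represents_linear (c : C) u v F G :
  represents u F -> represents v G ->
  represents (fun n => c *: u n + v n) (fun w => c * F w + G w).
Proof.
move=> [uC uF] [vC vG]; split; first exact: vcauchy_linear.
move=> w; under eq_fun do rewrite sdot_linear.
exact: clim_linear (uF w) (vG w).
Qed.

Lemma represents_cst w : represents (fun _ => w) (h w).
Proof.
split=> [e e0|x]; last exact: clim_cst.
by exists 0 => n m _ _; rewrite subrr /snorm sdot0l sqrtC0.
Qed.

Lemma represents_unif u F : represents u F ->
  forall e, 0 < e -> exists N, forall n w, (N <= n)%N ->
    `|h (u n) w - F w| <= e * snorm h w.
Proof.
move=> [uC uF] e e0; have [N uN] := uC _ e0; exists N => n w Nn.
rewrite distrC addrC -mulN1r.
apply: clim_norm_le (clim_linear (-1) (clim_cst (h (u n) w)) (uF w)).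
exists N => k Nk; rewrite mulN1r addrC -sdotBl (le_trans (sdot_CS _ _ _))//.
by rewrite ler_wpM2r ?snorm_ge0// ltW// uN.
Qed.

Lemma sdot_cauchy_cvg u v : vcauchy u -> vcauchy v ->
  exists l, clim (fun n => h (u n) (v n)) l.
Proof.
move=> uC vC; apply: complex_cauchy_cvg => e e0.
have [K K0 [N1 uK]] := vcauchy_bounded uC.
have [L L0 [N2 vL]] := vcauchy_bounded vC.
have [M1 uM] := uC _ (divr_gt0 (divr_gt0 e0 (ltr0n C 2)) L0).
have [M2 vM] := vC _ (divr_gt0 (divr_gt0 e0 (ltr0n C 2)) K0).
exists (maxn (maxn N1 N2) (maxn M1 M2)) => n m.
rewrite !geq_max => /andP[/andP[n1 n2] /andP[n3 n4]] /andP[/andP[m1 m2] /andP[m3 m4]].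
have -> : h (u n) (v n) - h (u m) (v m) =
    h (u n - u m) (v n) + h (u m) (v n - v m).
  by rewrite sdotBl sdotBr addrA subrK.
apply: le_lt_trans (ler_normD _ _) _; rewrite [e]splitr ltrD//.
  apply: le_lt_trans (sdot_CS _ _ _) _.
  have := uM _ _ n3 m3; rewrite ltr_pdivlMr//; apply: le_lt_trans.
  by rewrite ler_wpM2l ?snorm_ge0// vL.
apply: le_lt_trans (sdot_CS _ _ _) _; rewrite mulrC.
have := vM _ _ n4 m4; rewrite ltr_pdivlMr//; apply: le_lt_trans.
by rewrite ler_wpM2l ?snorm_ge0// uK.
Qed.

Lemma vcauchy_represents u : vcauchy u -> exists F, represents u F.
Proof.
move=> uC; have [F uF] := choice (fun w =>
  sdot_cauchy_cvg uC (represents_cst w).1).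
by exists F.
Qed.

Lemma represents_cvg u v F l : represents u F -> vcauchy v ->
  clim (fun n => h (u n) (v n)) l -> clim (fun n => F (v n)) l.
Proof.
move=> uF vC; apply: clim_dist0 => e e0.
have [K K0 [N vK]] := vcauchy_bounded vC.
have [M uM] := represents_unif uF (divr_gt0 e0 K0).
exists (maxn N M) => n; rewrite geq_max => /andP[Nn Mn].
apply: (le_trans (uM _ _ Mn)); rewrite -ler_pdivlMl ?divr_gt0//.
by rewrite invf_div divfK ?gt_eqF// vK.
Qed.

Lemma represents_dot_unique u u' v v' F G l l' :
  represents u F -> represents u' F -> represents v G -> represents v' G ->
  clim (fun n => h (u n) (v n)) l ->
  clim (fun n => h (u' n) (v' n)) l' -> l = l'.
Proof.
move=> uF u'F vG v'G uvl u'vl'.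
have [m u'vm] := sdot_cauchy_cvg u'F.1 vG.1.
have -> : l = m.
  apply: clim_unique; first exact: (represents_cvg uF vG.1 uvl).
  exact: (represents_cvg u'F vG.1 u'vm).
apply: (can_inj (@conjCK C)).
have sw x y : h x y = (h y x)^* by exact: sdotC.
have flip x y k : clim (fun n => h (x n) (y n)) k ->
    clim (fun n => h (y n) (x n)) k^*.
  by move=> /clim_conjC; under eq_fun do rewrite -sw.
apply: clim_unique; first exact: (represents_cvg vG u'F.1 (flip _ _ _ u'vm)).
exact: (represents_cvg v'G u'F.1 (flip _ _ _ u'vl')).
Qed.

(* A vector of the completion is the functional [w |-> lim <u n, w>] for a Cauchy
   sequence [u]; vectors are then equal as soon as they agree as functions. *)
Record completion := Completion {
  cfun :> V -> C;
  cfun_represented : exists u, represents u cfun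
}.

Implicit Types (x y z : completion) (a b : C).

Lemma cfun_inj x y : x =1 y -> x = y.
Proof.
case: x y => [F Fu] [G Gu] /= /funext FG; move: Fu Gu; rewrite FG => Fu Gu.
by congr Completion; apply: Prop_irrelevance.
Qed.

Lemma completion_lin_proof a x y : exists u, represents u (fun w => a * x w + y w).
Proof.
have [u ux] := cfun_represented x; have [v vy] := cfun_represented y.
by exists (fun n => a *: u n + v n); apply: represents_linear.
Qed.

Definition completion_lin a x y := Completion (completion_lin_proof a x y).

Definition embed (w : V) := @Completion (h w)
  (ex_intro (fun u => represents u (h w)) (fun _ => w) (represents_cst w)).

Definition completion_add x y := completion_lin 1 x y.
Definition completion_opp x := completion_lin (-1) x (embed 0).
Definition completion_scale a x := completion_lin a x (embed 0).

Lemma completion_addA : associative completion_add.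
Proof. by move=> x y z; apply: cfun_inj => w /=; rewrite !mul1r addrA. Qed.
Lemma completion_addC : commutative completion_add.
Proof. by move=> x y; apply: cfun_inj => w /=; rewrite !mul1r addrC. Qed.
Lemma completion_add0 : left_id (embed 0) completion_add.
Proof. by move=> x; apply: cfun_inj => w /=; rewrite mul1r sdot0l add0r. Qed.
Lemma completion_addN : left_inverse (embed 0) completion_opp completion_add.
Proof.
by move=> x; apply: cfun_inj => w /=; rewrite sdot0l mul1r mulN1r addr0 addNr.
Qed.

HB.instance Definition _ := gen_eqMixin completion.
HB.instance Definition _ := gen_choiceMixin completion.
HB.instance Definition _ := GRing.isZmodule.Build completion
  completion_addA completion_addC completion_add0 completion_addN.

Lemma completion_scaleA a b x :
  completion_scale a (completion_scale b x) = completion_scale (a * b) x.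
Proof. by apply: cfun_inj => w /=; rewrite sdot0l !addr0 mulrA. Qed.
Lemma completion_scale1 : left_id 1 completion_scale.
Proof. by move=> x; apply: cfun_inj => w /=; rewrite sdot0l addr0 mul1r. Qed.
Lemma completion_scaleDr : right_distributive completion_scale +%R.
Proof.
by move=> a x y; apply: cfun_inj => w /=; rewrite sdot0l !addr0 !mul1r mulrDr.
Qed.
Lemma completion_scaleDl x : {morph completion_scale^~ x : a b / a + b}.
Proof.
by move=> a b; apply: cfun_inj => w /=; rewrite sdot0l !addr0 !mul1r mulrDl.
Qed.

HB.instance Definition _ := GRing.Zmodule_isLmodule.Build C completion
  completion_scaleA completion_scale1 completion_scaleDr completion_scaleDl.

Lemma cfun_linear a x y w : (a *: x + y) w = a * x w + y w.
Proof. by rewrite /= sdot0l addr0 mul1r. Qed.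

End Completion.

Section CompletionDot.
Context {R : realType} {V : lmodType R[i]} (h : semi_dot V).
Local Notation C := R[i].
Local Notation H := (completion h).
Implicit Types (F G K : H) (u v : nat -> V) (e : C).

Lemma completion_repr F : {u | represents h u F}.
Proof. by apply: cid; apply: cfun_represented. Qed.

Definition approx F : nat -> V := projT1 (completion_repr F).

Lemma approxP F : represents h (approx F) F.
Proof. exact: projT2 (completion_repr F). Qed.

Definition cdot_spec F G : {l |
  clim (fun n => h (approx F n) (approx G n)) l}.
Proof. by apply: cid; apply: sdot_cauchy_cvg; apply: (approxP _).1. Defined.

Definition cdot F G : C := projT1 (cdot_spec F G).

Lemma cdot_cvg u v F G : represents h u F -> represents h v G ->
  clim (fun n => h (u n) (v n)) (cdot F G).
Proof.
move=> uF vG; have [l ul] := sdot_cauchy_cvg uF.1 vG.1.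
suff -> : cdot F G = l by [].
exact: represents_dot_unique (approxP F) uF (approxP G) vG (projT2 (cdot_spec F G)) ul.
Qed.

Lemma cdotE u v F G l : represents h u F -> represents h v G ->
  clim (fun n => h (u n) (v n)) l -> cdot F G = l.
Proof. by move=> uF vG; apply: clim_unique; apply: cdot_cvg. Qed.

Lemma cdot_linear (c : C) F G K : cdot (c *: F + G) K = c * cdot F K + cdot G K.
Proof.
have [[uF vG] wK] := (approxP F, approxP G, approxP K).
have sumP : represents h (fun n => c *: approx F n + approx G n) (c *: F + G : H).
  split; first exact: (represents_linear c uF vG).1.
  by move=> w; rewrite cfun_linear; apply: (represents_linear c uF vG).2.
have FK := cdot_cvg uF wK; have GK := cdot_cvg vG wK.
apply: cdotE sumP wK _.
under eq_fun do rewrite sdot_linear.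
exact: clim_linear FK GK.
Qed.

Lemma cdotC F G : cdot F G = (cdot G F)^*.
Proof.
apply: cdotE (approxP F) (approxP G) _; under eq_fun do rewrite sdotC.
exact: clim_conjC (cdot_cvg (approxP G) (approxP F)).
Qed.

Lemma cdot_ge0 F : 0 <= cdot F F.
Proof.
apply: clim_ge0 (cdot_cvg (approxP F) (approxP F)) => n; exact: sdot_ge0.
Qed.

Definition completion_dot : semi_dot H := SemiDot cdot_linear cdotC cdot_ge0.

Lemma embed_represents w : represents h (fun _ => w) (embed h w).
Proof. exact: represents_cst. Qed.

Lemma embed_linear (c : C) w w' : embed h (c *: w + w') = c *: embed h w + embed h w'.
Proof. by apply: cfun_inj => x; rewrite cfun_linear /= sdot_linear. Qed.

Lemma cdot_embed F w : cdot F (embed h w) = F w.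
Proof.
apply: cdotE (approxP F) (embed_represents w) _.
exact: (approxP F).2.
Qed.

Lemma cdot_definite F : cdot F F = 0 -> F = 0.
Proof.
move=> F0; apply: cfun_inj => w.
have E0 : cdot (embed h w) F = 0 by exact: (@sdot_null _ _ completion_dot).
by rewrite -cdot_embed cdotC E0 conjC0 /= sdot0l.
Qed.

Lemma snorm_embed w : snorm completion_dot (embed h w) = snorm h w.
Proof. by rewrite /snorm /= cdot_embed. Qed.

Lemma embed_approx u F : represents h u F ->
  forall e, 0 < e -> exists N, forall n, (N <= n)%N ->
    snorm completion_dot (F - embed h (u n)) <= e.
Proof.
move=> uF e e0; have [N uN] := uF.1 _ e0; exists N => n Nn.
rewrite -(@ler_pXn2r _ 2) ?nnegrE ?snorm_ge0 ?(ltW e0)// snorm_sqr /=.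
have Fu : represents h (fun k => u k - u n) (F - embed h (u n)).
  have [uC' uF'] := represents_linear (-1) (embed_represents (u n)) uF.
  have Eu : (fun k => -1 *: u n + u k) = (fun k => u k - u n).
    by apply/funext => k; rewrite scaleN1r addrC.
  split=> [|w]; first by rewrite -Eu.
  have -> : (F - embed h (u n)) w = -1 * embed h (u n) w + F w.
    by rewrite addrC -scaleN1r cfun_linear.
  by under eq_fun do rewrite -[u _ - _]addrC -scaleN1r; apply: uF'.
rewrite -[leLHS]ger0_norm ?cdot_ge0//.
apply: clim_norm_le (cdot_cvg Fu Fu); exists N => k Nk.
rewrite ger0_norm ?sdot_ge0// -snorm_sqr ler_pXn2r// ?nnegrE ?snorm_ge0 ?(ltW e0)//.
exact/ltW/uN.
Qed.

Lemma embed_dense F e : 0 < e -> exists w, snorm completion_dot (F - embed h w) <= e.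
Proof.
by move=> /(embed_approx (approxP F))[N /(_ _ (leqnn _)) ?]; exists (approx F N).
Qed.

Lemma completion_norm0 F : snorm completion_dot F = 0 -> F = 0.
Proof. by move=> F0; apply: cdot_definite; have := snorm_sqr completion_dot F; rewrite F0 expr0n => /esym. Qed.

HB.instance Definition _ := Lmodule_isNormed.Build C H
  (snormD completion_dot) (snormZ completion_dot) completion_norm0.

Lemma completion_normE F : `|F| = snorm completion_dot F.
Proof. by []. Qed.

Lemma completion_complete (A : set_system H) : ProperFilter A -> cauchy A -> cvg A.
Proof.
move=> AA /cauchyP Aex.
have inv_gt0 n : 0 < n.+1%:R^-1 :> C by rewrite invr_gt0 ltr0n.
have near_embed n : exists w, A (ball (embed h w) (n.+1%:R^-1 + n.+1%:R^-1 : C)).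
  have [F AF] := Aex _ (inv_gt0 n); have [w Fw] := embed_dense F (inv_gt0 n).
  exists w; apply: filterS AF => G; rewrite -!ball_normE /= => FG.
  rewrite -(subrK F (embed h w)) -addrA (le_lt_trans (ler_normD _ _))//.
  by rewrite ler_ltD// distrC.
have [u uA] := choice near_embed.
have ball_lt e : 0 < e -> exists N, forall n, (N <= n)%N ->
    n.+1%:R^-1 + n.+1%:R^-1 < e / 2 :> C.
  move=> e0; have [N Ne] := pos_inv_lt (divr_gt0 (divr_gt0 e0 (ltr0n C 2)) (ltr0n C 2)).
  exists N => n Nn; rewrite (splitr (e / 2)).
  have nN : n.+1%:R^-1 <= N.+1%:R^-1 :> C.
    by rewrite lef_pV2 ?posrE ?ltr0n// ler_nat.
  by rewrite ltrD// (le_lt_trans nN).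
have uC : vcauchy h u.
  move=> e /ball_lt[N Ne]; exists N => n m /Ne ne /Ne me.
  have [G []] := filter_ex (filterI (uA n) (uA m)).
  rewrite -!ball_normE /= => nG mG.
  rewrite -snorm_embed addrC -scaleN1r embed_linear scaleN1r addrC.
  rewrite -completion_normE -(subrK G (embed h (u n))) -addrA.
  rewrite (le_lt_trans (ler_normD _ _))// [e]splitr ltrD//.
    exact: lt_trans nG ne.
  by rewrite distrC; apply: lt_trans mG me.
have [F uF] := vcauchy_represents uC.
have FP : exists u, represents h u F by exists u.
apply/cvg_ex; exists (Completion FP); apply/cvgrPdist_lt => e e0.
have [N Ne] := ball_lt _ e0.
have [M Me] := @embed_approx u (Completion FP) uF _ (divr_gt0 e0 (ltr0n C 2)).
pose n := maxn N M; apply: filterS (uA n) => G; rewrite -ball_normE /= => nG.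
rewrite -(subrK (embed h (u n)) (Completion FP)) -addrA.
rewrite (le_lt_trans (ler_normD _ _))// [e]splitr ler_ltD//.
  exact: Me (leq_maxr _ _).
exact: lt_trans nG (Ne _ (leq_maxl _ _)).
Qed.

HB.instance Definition _ := Uniform_isComplete.Build H completion_complete.

Lemma cdot_bilinear : bilinear_for
  ( *%R : GRing.Scale.law C C) (Num.conj \; *%R : GRing.Scale.law C C) cdot.
Proof.
split=> F c G K; first exact: cdot_linear.
by have /= := sdotDr completion_dot F (c *: G) K; have /= -> := sdotZr completion_dot c F G.
Qed.

HB.instance Definition _ := bilinear_isBilinear.Build C H H C
  _ _ cdot cdot_bilinear.

Lemma cdot_hermitian F G : cdot F G = (-1) ^+ false * (cdot G F)^*.
Proof. by rewrite mul1r cdotC. Qed.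

HB.instance Definition _ :=
  isHermitianSesquilinear.Build C H false Num.conj cdot cdot_hermitian.

Lemma cdot_gt0 F : F != 0 -> 0 < cdot F F.
Proof.
by move=> F0; rewrite lt_def cdot_ge0 andbT; apply: contra_neq F0; apply: cdot_definite.
Qed.

HB.instance Definition _ := isDotProduct.Build C H cdot cdot_gt0.

Lemma cdot_norm F : cdot F F = `|F| ^+ 2.
Proof. by rewrite completion_normE (snorm_sqr completion_dot). Qed.

HB.instance Definition _ := @isHilbert.Build R H
  (cdot : {dot H for @Num.conj C}) cdot_norm.

Lemma completion_hdotE F G : hdot F G = cdot F G.
Proof. by []. Qed.

End CompletionDot.

Lemma linear_bounded_continuous (K : numFieldType) (V W : normedModType K)
    (f : V -> W) (c : K) :
  0 < c -> linear f -> (forall x, `|f x| <= c * `|x|) -> continuous f.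
Proof.
move=> c0 flin fc x; apply/cvgrPdist_lt => e e0; have d0 := divr_gt0 e0 c0.
apply: filterS (nbhsx_ballx x _ d0) => y; rewrite -ball_normE /= => xy.
have := flin (-1) y x; rewrite !scaleN1r => E; rewrite addrC -E addrC.
by rewrite (le_lt_trans (fc _))// mulrC -ltr_pdivlMr.
Qed.

Section LiftOperator.
Context {R : realType} {V : lmodType R[i]} (h : semi_dot V).
Local Notation C := R[i].
Local Notation H := (completion h).

Definition adjoint_pair (T T' : V -> V) :=
  [/\ linear T, forall v w, h (T v) w = h v (T' w) &
      exists2 c, 0 <= c & forall v, h (T v) (T v) <= c * h v v].

Lemma adjoint_pair_snorm T T' : adjoint_pair T T' ->
  exists2 c, 0 < c & forall v, snorm h (T v) <= c * snorm h v.
Proof.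
move=> [_ _ [c c0 Tc]]; exists (sqrtC c + 1).
  by rewrite ltr_wpDl// sqrtC_ge0.
move=> v; apply: (@le_trans _ _ (sqrtC c * snorm h v)).
  rewrite /snorm -sqrtCM ?nnegrE ?sdot_ge0// ler_sqrtC ?nnegrE//.
  - exact: sdot_ge0.
  - by rewrite mulr_ge0 ?sdot_ge0.
by rewrite ler_wpM2r ?snorm_ge0// lerDl.
Qed.

Lemma represents_adjoint T T' u F : adjoint_pair T T' -> represents h u F ->
  represents h (fun n => T (u n)) (fun w => F (T' w)).
Proof.
move=> TT' [uC uF]; have [Tlin Tadj _] := TT'.
have [c c0 Tc] := adjoint_pair_snorm TT'.
split=> [e e0|w e e0]; last first.
  by have [N Ne] := uF (T' w) e e0; exists N => n Nn; rewrite Tadj; apply: Ne.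
have [N uN] := uC _ (divr_gt0 e0 c0); exists N => n m Nn Nm.
have -> : T (u n) - T (u m) = T (u n - u m).
  by have := Tlin (-1) (u m) (u n); rewrite !scaleN1r => E; rewrite addrC -E addrC.
by rewrite (le_lt_trans (Tc _))// mulrC -ltr_pdivlMr// uN.
Qed.

Lemma lift_proof T T' (TT' : adjoint_pair T T') (F : H) :
  exists u, represents h u (fun w => F (T' w)).
Proof.
by exists (fun n => T (approx F n)); apply: represents_adjoint (approxP F).
Qed.

(* An operator is extended through its adjoint, so that no limit is chosen. *)
Definition lift_fun T T' (TT' : adjoint_pair T T') (F : H) : H :=
  Completion (lift_proof TT' F).

Lemma lift_represents T T' (TT' : adjoint_pair T T') u (F : H) :
  represents h u F -> represents h (fun n => T (u n)) (lift_fun TT' F).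
Proof. exact: represents_adjoint. Qed.

Lemma lift_fun_linear T T' (TT' : adjoint_pair T T') : linear (lift_fun TT').
Proof. by move=> c F G; apply: cfun_inj => w; rewrite [RHS]cfun_linear; apply: cfun_linear. Qed.

Lemma lift_fun_bounded T T' (TT' : adjoint_pair T T') :
  exists2 c : C, 0 < c & forall F : H, `|lift_fun TT' F| <= c * `|F|.
Proof.
have [_ _ [c c0 Tc]] := TT'.
have c1 : 0 < c + 1 by rewrite ltr_wpDl.
exists (c + 1) => // F.
rewrite -(@ler_pXn2r _ 2) ?nnegrE ?mulr_ge0 ?(ltW c1)// exprMn -!cdot_norm.
apply: (@le_trans _ _ (c * cdot F F)); last first.
  rewrite ler_wpM2r ?cdot_ge0// (@le_trans _ _ (c + 1))// ?lerDl//.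
  by rewrite -[leLHS]mulr1 expr2 ler_wpM2l ?(ltW c1)// lerDr.
rewrite -subr_ge0 addrC -mulN1r.
have FF := cdot_cvg (approxP F) (approxP F).
have TF := cdot_cvg (lift_represents TT' (approxP F)) (lift_represents TT' (approxP F)).
have FF' := clim_linear c FF (clim_cst 0); rewrite addr0 in FF'.
apply: clim_ge0 (clim_linear (-1) TF FF') => n /=.
by rewrite mulN1r addr0 addrC subr_ge0 Tc.
Qed.

Lemma lift_bounded_op T T' (TT' : adjoint_pair T T') : bounded_op (lift_fun TT').
Proof.
split; first exact: lift_fun_linear.
have [c c0 Tc] := lift_fun_bounded TT'.
exact: (linear_bounded_continuous c0 (lift_fun_linear TT') Tc).
Qed.

Definition lift T T' (TT' : adjoint_pair T T') : bop H := Bop (lift_bounded_op TT').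

Lemma lift_embed T T' (TT' : adjoint_pair T T') v : lift TT' (embed h v) = embed h (T v).
Proof. by have [_ Tadj _] := TT'; apply: cfun_inj => w; rewrite /= Tadj. Qed.

Lemma lift_adjoint T T' T'' (TT' : adjoint_pair T T') (T'T'' : adjoint_pair T' T'') :
  is_adjoint (lift TT') (lift T'T'').
Proof.
move=> F G; rewrite !completion_hdotE.
have FG := cdot_cvg (approxP F) (lift_represents T'T'' (approxP G)).
apply: cdotE (lift_represents TT' (approxP F)) (approxP G) _.
by move=> e e0; have [N Ne] := FG e e0; exists N => n Nn; have [_ -> _] := TT'; apply: Ne.
Qed.

Lemma liftE T T' (TT' : adjoint_pair T T') (F : H) w : lift TT' F w = F (T' w).
Proof. by []. Qed.

End LiftOperator.

(** * Representations of the game algebra *)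

Definition pvm (T : pzRingType) (I J : finType) (p : I -> J -> T) :=
  (forall i j k, p i j * p i k = if j == k then p i j else 0) /\
  (forall i, \sum_j p i j = 1).

Section GameRepresentation.
Context {R : realType} {X Y A B : finType} {H : hilbertType R}.
Local Notation C := R[i].
Local Notation U := (game_alg R[i] X Y A B).
Local Notation F := (free_alg C (gens X Y A B)).

Lemma bop_scalerAl (c : C) (S T : bop H) : c *: (S * T) = (c *: S) * T.
Proof. exact: bopP. Qed.

Lemma bop0 (S : bop H) : S 0 = 0.
Proof. by have := bop_linear S (-1) 0 0; rewrite scaler0 addr0 scaleN1r addNr. Qed.

Lemma bopZ (S : bop H) (c : C) x : S (c *: x) = c *: S x.
Proof. by have := bop_linear S c x 0; rewrite bop0 !addr0. Qed.

Lemma bop_scalerAr (c : C) (S T : bop H) : c *: (S * T) = S * (c *: T).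
Proof. by apply: bopP => x; rewrite /= bopZ. Qed.

Section FreeLift.
Variable g : gens X Y A B -> bop H.

Definition word_op (w : fmonom (gens X Y A B)) : bop H :=
  foldr (fun i T => g i * T) 1 (fmonom_val w).

Definition free_lift (u : F) : bop H :=
  \sum_(w <- msupp u) mcoeff w u *: word_op w.

Lemma free_liftE (d : {fset fmonom (gens X Y A B)}) (u : F) :
  (forall w, w \in msupp u -> w \in d) ->
  free_lift u = \sum_(w <- d) mcoeff w u *: word_op w.
Proof.
move=> /fsubsetP ud; rewrite /free_lift (big_fset_incl _ ud)//= => w _ wu.
by rewrite mcoeff_outdom// scale0r.
Qed.

Lemma free_lift_linear (c : C) (u v : F) :
  free_lift (c *: u + v) = c *: free_lift u + free_lift v.
Proof.
pose d := (msupp u `|` msupp v `|` msupp (c *: u + v))%fset.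
have [ud vd wd] : [/\ msupp u `<=` d, msupp v `<=` d & msupp (c *: u + v) `<=` d]%fset.
  by split; apply/fsubsetP => w ww; rewrite !inE ww ?orbT.
rewrite (free_liftE (fsubsetP ud)) (free_liftE (fsubsetP vd)) (free_liftE (fsubsetP wd)).
rewrite scaler_sumr -big_split /=; apply: eq_bigr => w _.
by rewrite mcoeffD mcoeffZ scalerDl scalerA.
Qed.

Lemma free_liftU w (c : C) : free_lift (mkmalgU w c) = c *: word_op w.
Proof.
rewrite (@free_liftE [fset w]%fset); first by rewrite big_seq_fset1 mcoeffUU.
by move=> v; move/fsubsetP: (@msuppU_le _ _ w c) => /(_ v).
Qed.

Lemma word_op_mul v w : word_op (fmmul v w) = word_op v * word_op w.
Proof.
rewrite /word_op /fmmul fmE /=.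
by elim: (fmonom_val v) => [|i s IH] /=; rewrite ?mul1r// IH mulrA.
Qed.

Lemma free_lift0 : free_lift 0 = 0.
Proof. by rewrite /free_lift msupp0 big_seq_fset0. Qed.

Lemma free_liftD : {morph free_lift : u v / u + v}.
Proof. by move=> u v; rewrite -[u]scale1r free_lift_linear !scale1r. Qed.

Lemma free_lift1 : free_lift 1 = 1.
Proof.
rewrite -[1 : F]/(mkmalgU (fmone _) 1) free_liftU scale1r.
by rewrite /word_op /fmone fmE.
Qed.

Lemma free_liftM (u v : F) : free_lift (u * v) = free_lift u * free_lift v.
Proof.
have sumE := big_morph free_lift free_liftD free_lift0.
rewrite [u]free_algE [v]free_algE mulr_suml !sumE mulr_suml.
apply: eq_bigr => i _; rewrite !mulr_sumr sumE; apply: eq_bigr => j _.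
rewrite free_alg_mulU !free_liftU word_op_mul -bop_scalerAl -bop_scalerAr.
by rewrite scalerA.
Qed.

Lemma free_lift_gen i : free_lift (fgen i) = g i.
Proof.
rewrite /fgen free_liftU scale1r /word_op fmuE /=.
by rewrite mulr1.
Qed.

End FreeLift.

Section GameLift.
Variables (E1 : X -> A -> bop H) (E2 : Y -> B -> bop H).
Hypotheses (E1_pvm : pvm E1) (E2_pvm : pvm E2).
Hypothesis E_comm : forall x a y b, E1 x a * E2 y b = E2 y b * E1 x a.
Hypothesis E1_adj : forall x a, is_adjoint (E1 x a) (E1 x a).
Hypothesis E2_adj : forall y b, is_adjoint (E2 y b) (E2 y b).

Definition gen_op (i : gens X Y A B) : bop H :=
  match i : (X * A + Y * B)%type with
  | inl p => E1 p.1 p.2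
  | inr p => E2 p.1 p.2
  end.

Local Notation lift := (free_lift gen_op).

Lemma lift_fe1 x a : lift (fe1 C _ B x a) = E1 x a.
Proof. exact: free_lift_gen. Qed.

Lemma lift_fe2 y b : lift (fe2 C X A y b) = E2 y b.
Proof. exact: free_lift_gen. Qed.

Lemma free_liftB (u v : F) : lift (u - v) = lift u - lift v.
Proof.
by rewrite -scaleN1r addrC free_lift_linear scaleN1r addrC.
Qed.

Lemma lift_relation r : game_relation r -> lift r = 0.
Proof.
have sumE := big_morph lift (free_liftD gen_op) (free_lift0 gen_op).
have commE (u v : F) : lift (u * v - v * u) = lift u * lift v - lift v * lift u.
  by rewrite (free_liftB (u * v) (v * u)); congr (_ - _); apply: free_liftM.
have sqE (u : F) : lift (u ^+ 2 - u) = lift u * lift u - lift u.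
  by rewrite expr2 (free_liftB (u * u) u) (free_liftM gen_op u u).
have B1E (u : F) : lift (u - 1) = lift u - 1 by rewrite (free_liftB u 1) free_lift1.
case=> [x a y b|x a|y b|x a1 a2 n|y b1 b2 n|x|y].
- by rewrite (commE (fe1 C _ _ x a) (fe2 C _ _ y b)) lift_fe1 lift_fe2 E_comm subrr.
- by rewrite (sqE (fe1 C _ _ x a)) lift_fe1 E1_pvm.1 eqxx subrr.
- by rewrite (sqE (fe2 C _ _ y b)) lift_fe2 E2_pvm.1 eqxx subrr.
- by rewrite (free_liftM gen_op (fe1 C _ _ x a1) (fe1 C _ _ x a2)) 2!lift_fe1 E1_pvm.1 (negbTE n).
- by rewrite (free_liftM gen_op (fe2 C _ _ y b1) (fe2 C _ _ y b2)) 2!lift_fe2 E2_pvm.1 (negbTE n).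
- rewrite B1E sumE -(E1_pvm.2 x); apply/eqP; rewrite subr_eq0.
  by apply/eqP; apply: eq_bigr => a _; rewrite lift_fe1.
- rewrite B1E sumE -(E2_pvm.2 y); apply/eqP; rewrite subr_eq0.
  by apply/eqP; apply: eq_bigr => b _; rewrite lift_fe2.
Qed.

Lemma lift_ideal r : ideal_gen setT (@game_relation C X Y A B) r -> lift r = 0.
Proof.
move: r; apply: smallest_sub; last exact: lift_relation.
split=> //=; first exact: free_lift0.
- by move=> u v; rewrite free_liftD => -> ->; rewrite addr0.
- by move=> u v _; rewrite free_liftM => ->; rewrite mulr0.
- by move=> u v; rewrite free_liftM => -> _; rewrite mul0r.
Qed.

Definition game_lift (u : U) : bop H := lift (repr u).

Lemma game_lift_to_quot u : game_lift (to_quot _ u) = lift u.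
Proof. by apply/eqP; rewrite -subr_eq0 -free_liftB lift_ideal//; apply: repr_to_quot. Qed.

Lemma game_lift_e1 x a : game_lift (e1 x a) = E1 x a.
Proof. by rewrite game_lift_to_quot lift_fe1. Qed.

Lemma game_lift_e2 y b : game_lift (e2 y b) = E2 y b.
Proof. by rewrite game_lift_to_quot lift_fe2. Qed.

Lemma free_star_word (w : fmonom (gens X Y A B)) :
  is_adjoint (word_op gen_op w) (word_op gen_op (fm_rev w)).
Proof.
have gen_adj i : is_adjoint (gen_op i) (gen_op i).
  by case: i => -[? ?]; [apply: E1_adj|apply: E2_adj].
case: w => s; rewrite /word_op /fm_rev /=; elim: s => [|i s IH] //= x y.
have -> : foldr (fun i T => gen_op i * T) 1 (rev (i :: s)) =
    foldr (fun i T => gen_op i * T) 1 (rev s) * gen_op i.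
  rewrite rev_cons -cats1; elim: (rev s) => [|j t IHt] /=.
    by rewrite mulr1 mul1r.
  by rewrite IHt mulrA.
by rewrite -[LHS]/(hdot (gen_op i (_ x)) y) gen_adj IH.
Qed.

Lemma lift_star (u : F) : is_adjoint (lift u) (lift (free_star u)).
Proof.
have sumE := big_morph lift (free_liftD gen_op) (free_lift0 gen_op).
move=> x y; rewrite /free_star sumE.
have opsum (r : seq (fmonom (gens X Y A B))) (G : _ -> bop H) z :
    (\sum_(w <- r) G w) z = \sum_(w <- r) G w z.
  by elim: r => [|w r IH]; rewrite ?big_nil// !big_cons -IH.
rewrite [lift u]/free_lift !opsum linear_sumlz linear_sumr; apply: eq_bigr => w _.
by rewrite free_liftU /= linearZl linearZr /= conjCK free_star_word.
Qed.

Lemma game_lift_rep : star_rep setT game_lift.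
Proof.
split.
- by rewrite -[1]/(to_quot (@game_relation C X Y A B) 1) game_lift_to_quot free_lift1.
- move=> c u v _ _; elim/game_algW: u => u; elim/game_algW: v => v.
  by rewrite -to_quotZ -to_quotD !game_lift_to_quot free_lift_linear.
- move=> u v _ _; elim/game_algW: u => u; elim/game_algW: v => v.
  by rewrite -to_quotM !game_lift_to_quot free_liftM.
- move=> u _; elim/game_algW: u => u.
  by rewrite star_to_quot !game_lift_to_quot; apply: lift_star.
Qed.

End GameLift.
End GameRepresentation.

Section GameAlgebraTheory.
Context {R : realType} {X Y A B : finType}.
Local Notation C := R[i].
Local Notation U := (game_alg R[i] X Y A B).
Implicit Types (u v w : U) (c : C).

Lemma game_alg_ind (P : set U) : subalgebra P ->
  (forall x a, P (e1 x a)) -> (forall y b, P (e2 y b)) -> forall u, P u.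
Proof.
move=> [P1 Plin PM] Pe1 Pe2.
have P0 : P 0 by rewrite -(addNr 1) -scaleN1r; apply: Plin.
have sumE := big_morph (to_quot (@game_relation C X Y A B)) (to_quotD _) erefl.
elim/game_algW => u; rewrite [u]free_algE sumE.
elim: (msupp u : seq _) => [|w r IH]; rewrite ?big_nil// big_cons.
have -> : mkmalgU w (mcoeff w u) = mcoeff w u *: (mkmalgU w 1 : free_alg C (gens X Y A B)).
  by rewrite free_alg_scaleU mulr1.
rewrite to_quotZ; apply: Plin IH.
case: w => s; elim: s => [|i s IHs].
  suff -> : mkmalgU (FMonom [::]) 1 = 1 :> free_alg C (gens X Y A B) by [].
  by rewrite -[RHS]/(mkmalgU (fmone _) 1) /fmone fmE.
have -> : mkmalgU (FMonom (i :: s)) 1 = fgen i * mkmalgU (FMonom s) 1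
    :> free_alg C (gens X Y A B).
  rewrite /fgen free_alg_mulU mulr1; congr mkmalgU.
  by apply: val_inj; rewrite /= /fmmul fmuE fmE.
rewrite to_quotM; apply: PM IHs.
by case: i => -[? ?]; [apply: Pe1|apply: Pe2].
Qed.

End GameAlgebraTheory.

(** * The GNS construction for a trace *)

(* The library has no structure for possibly zero algebras, hence the explicit
   operations. *)
Record star_algebra (R : realType) (U : lmodType R[i]) := StarAlgebra {
  smul : U -> U -> U;
  sone : U;
  adj : U -> U;
  smulA : associative smul;
  smul1l : left_id sone smul;
  smul1r : right_id sone smul;
  smulPl : forall (c : R[i]) u v w, smul (c *: u + v) w = c *: smul u w + smul v w;
  smulPr : forall (c : R[i]) u v w, smul w (c *: u + v) = c *: smul w u + smul w v;
  adjK : involutive adj;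
  adjP : forall (c : R[i]) u v, adj (c *: u + v) = c^* *: adj u + adj v;
  adjM : forall u v, adj (smul u v) = smul (adj v) (adj u)
}.

Section TracialFunctionals.
Context {R : realType} {U : lmodType R[i]} (S : star_algebra U).
Local Notation C := R[i].
Local Notation "u ** v" := (smul S u v) (at level 40, left associativity).
Local Notation I := (sone S).
Local Notation adj := (adj S).
Implicit Types (u v w x y : U) (c : C).

Lemma smulDl u v w : (u + v) ** w = u ** w + v ** w.
Proof. by have := smulPl S 1 u v w; rewrite !scale1r. Qed.

Lemma smulDr u v w : w ** (u + v) = w ** u + w ** v.
Proof. by have := smulPr S 1 u v w; rewrite !scale1r. Qed.

Lemma smul0l w : 0 ** w = 0.
Proof. by apply: (addIr (0 ** w)); rewrite -smulDl !add0r. Qed.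

Lemma smul0r w : w ** 0 = 0.
Proof. by apply: (addIr (w ** 0)); rewrite -smulDr !add0r. Qed.

Lemma smulZl c u w : (c *: u) ** w = c *: (u ** w).
Proof. by have := smulPl S c u 0 w; rewrite smul0l !addr0. Qed.

Lemma smulZr c u w : w ** (c *: u) = c *: (w ** u).
Proof. by have := smulPr S c u 0 w; rewrite smul0r !addr0. Qed.

Lemma smul_suml (J : Type) (r : seq J) (P : pred J) (F : J -> U) w :
  (\sum_(i <- r | P i) F i) ** w = \sum_(i <- r | P i) F i ** w.
Proof. exact: (big_morph (smul S ^~ w) (fun u v => smulDl u v w) (smul0l w)). Qed.

Lemma smul_sumr (J : Type) (r : seq J) (P : pred J) (F : J -> U) w :
  w ** (\sum_(i <- r | P i) F i) = \sum_(i <- r | P i) w ** F i.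
Proof. exact: (big_morph (smul S w) (fun u v => smulDr u v w) (smul0r w)). Qed.

Lemma adjD u v : adj (u + v) = adj u + adj v.
Proof. by have := adjP S 1 u v; rewrite conjC1 !scale1r. Qed.

Lemma adj0 : adj 0 = 0.
Proof. by apply: (addIr (adj 0)); rewrite -adjD !add0r. Qed.

Lemma adjZ c u : adj (c *: u) = c^* *: adj u.
Proof. by have := adjP S c u 0; rewrite adj0 !addr0. Qed.

Lemma adj1 : adj I = I.
Proof. by rewrite -[LHS](smul1r S) -[X in _ ** X](adjK S) -adjM smul1r adjK. Qed.

Record tracial_functional := TracialFunctional {
  tfun :> U -> C;
  tfun_linear : forall c u v, tfun (c *: u + v) = c * tfun u + tfun v;
  tfun_trace : forall u v, tfun (u ** v) = tfun (v ** u);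
  tfun_ge0 : forall u, 0 <= tfun (adj u ** u);
  tfun1 : tfun I = 1
}.

Variable phi : tracial_functional.

Lemma tfunD u v : phi (u + v) = phi u + phi v.
Proof. by rewrite -[u]scale1r tfun_linear mul1r scale1r. Qed.

Lemma tfun0 : phi 0 = 0.
Proof. by apply: (addIr (phi 0)); rewrite -tfunD !add0r. Qed.

Lemma tfunZ c u : phi (c *: u) = c * phi u.
Proof. by rewrite -[c *: u]addr0 tfun_linear tfun0 addr0. Qed.

Definition gns_form u v : C := phi (adj v ** u).

Lemma gns_form_linear c u v w :
  gns_form (c *: u + v) w = c * gns_form u w + gns_form v w.
Proof. by rewrite /gns_form smulPr tfun_linear. Qed.

(* Polarization: a form that is real on the diagonal is hermitian. *)
Lemma gns_formC u v : gns_form u v = (gns_form v u)^*.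
Proof.
have real w : (gns_form w w)^* = gns_form w w.
  by apply/CrealP; rewrite ger0_real// tfun_ge0.
have lin2 c x y : gns_form (x + c *: y) (x + c *: y) =
    gns_form x x + c * c^* * gns_form y y + (c^* * gns_form x y + c * gns_form y x).
  rewrite /gns_form adjD adjZ smulDl !smulDr !smulZl !smulZr.
  by rewrite !tfunD !tfunZ; ring.
have herm c : (c^* * gns_form u v + c * gns_form v u)^* =
    c^* * gns_form u v + c * gns_form v u.
  have := real (u + c *: v); rewrite !lin2 !rmorphD !rmorphM /= conjCK !real.
  by rewrite [c^* * c]mulrC => /addrI.
have h1 := herm 1; have hi := herm 'i.
rewrite conjC1 !mul1r rmorphD /= in h1.
rewrite conjCi !mulNr rmorphD rmorphN !rmorphM /= conjCi in hi.
set a := gns_form u v in h1 hi *; set b := gns_form v u in h1 hi *.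
have hi2 : 'i * (a^* - b^*) = 'i * (b - a).
  by rewrite !mulrBr; move: hi; rewrite !mulNr opprK [- _ + _ in RHS]addrC.
have {}hi2 := mulfI (neq0Ci C) hi2.
apply: (@mulfI C 2); first by rewrite pnatr_eq0.
have -> : 2 * a = (a + b) - (b - a) by ring.
by rewrite -h1 -hi2; ring.
Qed.

Definition gns_dot : semi_dot U := SemiDot gns_form_linear gns_formC (tfun_ge0 phi).

Local Notation h := gns_dot.

Definition mul_bounded v :=
  exists2 c : C, 0 <= c & forall x, h (v ** x) (v ** x) <= c * h x x.

Lemma projection_mul_bounded e : adj e = e -> e ** e = e -> mul_bounded e.
Proof.
move=> se ee; exists 1 => // x; rewrite mul1r -subr_ge0.
have -> : h x x - h (e ** x) (e ** x) = h (x - e ** x) (x - e ** x).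
  have E : h (e ** x) (e ** x) = h x (e ** x).
    by rewrite /= /gns_form !adjM se !smulA -[adj x ** e ** e]smulA ee.
  have E' : h x (e ** x) = h (e ** x) x by rewrite /= /gns_form adjM se smulA.
  by rewrite sdotBl !sdotBr E E' subrr subr0.
exact: sdot_ge0.
Qed.

Lemma mul_bounded1 : mul_bounded I.
Proof. by exists 1 => // x; rewrite smul1l mul1r. Qed.

Lemma mul_bounded_linear c u v :
  mul_bounded u -> mul_bounded v -> mul_bounded (c *: u + v).
Proof.
move=> [a a0 ua] [b b0 vb]; exists (2 * (c * c^* * a) + 2 * b).
  by rewrite addr_ge0// mulr_ge0// mulr_ge0// mul_conjC_ge0.
move=> x; rewrite smulPl; set s := u ** x; set t := v ** x.
apply: (@le_trans _ _ (2 * (c * c^* * h s s) + 2 * h t t)).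
  rewrite -subr_ge0 (_ : _ - _ = h (c *: s - t) (c *: s - t)) ?sdot_ge0//.
  rewrite sdotBl !sdotBr sdotDl !sdotDr !sdotZl !sdotZr; ring.
rewrite [leRHS]mulrDl lerD//; last by rewrite -mulrA ler_wpM2l// vb.
by rewrite -!mulrA ler_wpM2l// mulrA [leRHS]mulrA ler_wpM2l ?mul_conjC_ge0// ua.
Qed.

Lemma mul_boundedM u v : mul_bounded u -> mul_bounded v -> mul_bounded (u ** v).
Proof.
move=> [a a0 ua] [b b0 vb]; exists (a * b); first exact: mulr_ge0.
by move=> x; rewrite -smulA (le_trans (ua _))// -mulrA ler_wpM2l// vb.
Qed.

Hypothesis all_mul_bounded : forall v, mul_bounded v.

Lemma left_pair v : adjoint_pair h (fun x => v ** x) (fun x => adj v ** x).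
Proof.
split; last exact: all_mul_bounded.
- by move=> c x y; rewrite smulPr.
- by move=> x y; rewrite /= /gns_form adjM adjK smulA.
Qed.

Lemma gns_form_star x y : h (adj x) (adj y) = h y x.
Proof. by rewrite /= /gns_form adjK tfun_trace. Qed.

Lemma right_pair v : adjoint_pair h (fun x => x ** v) (fun x => x ** adj v).
Proof.
split.
- by move=> c x y; rewrite smulPl.
- by move=> x y; rewrite /= /gns_form adjM adjK smulA tfun_trace smulA.
- have [c c0 vc] := all_mul_bounded (adj v); exists c => // x.
  by rewrite -gns_form_star adjM (le_trans (vc _))// gns_form_star.
Qed.

Local Notation H := (completion h).

Definition left_op v : bop H := lift (left_pair v).
Definition right_op v : bop H := lift (right_pair v).

Lemma cfun_antilinear (F : H) c x y : F (c *: x + y) = c^* * F x + F y.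
Proof.
rewrite -!cdot_embed embed_linear.
have D G G' : cdot F (G + G') = cdot F G + cdot F G' := sdotDr (completion_dot h) F G G'.
have Z G : cdot F (c *: G) = c^* * cdot F G := sdotZr (completion_dot h) c F G.
by rewrite D Z.
Qed.

Lemma left_op_linear c u v : left_op (c *: u + v) = c *: left_op u + left_op v.
Proof.
apply: bopP => F; apply: cfun_inj => x; rewrite [RHS]cfun_linear.
rewrite /left_op !liftE adjP smulPl cfun_antilinear.
by rewrite conjCK.
Qed.

Lemma left_opM u v : left_op (u ** v) = left_op u * left_op v.
Proof.
by apply: bopP => F; apply: cfun_inj => x; rewrite /= adjM smulA.
Qed.

Lemma left_op1 : left_op I = 1.
Proof. by apply: bopP => F; apply: cfun_inj => x; rewrite /= adj1 smul1l. Qed.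

Lemma left_op_adjoint u : is_adjoint (left_op u) (left_op (adj u)).
Proof. exact: lift_adjoint. Qed.

Lemma right_op_adjoint u : is_adjoint (right_op u) (right_op (adj u)).
Proof. exact: lift_adjoint. Qed.

Lemma right_opM u v : right_op (u ** v) = right_op v * right_op u.
Proof.
by apply: bopP => F; apply: cfun_inj => x; rewrite /= adjM smulA.
Qed.

Lemma right_op_linear c u v : right_op (c *: u + v) = c *: right_op u + right_op v.
Proof.
apply: bopP => F; apply: cfun_inj => x; rewrite [RHS]cfun_linear.
rewrite /right_op !liftE adjP smulPr cfun_antilinear.
by rewrite conjCK.
Qed.

Lemma right_op1 : right_op I = 1.
Proof. by apply: bopP => F; apply: cfun_inj => x; rewrite /= adj1 smul1r. Qed.

Lemma left_right_comm u v : left_op u * right_op v = right_op v * left_op u.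
Proof. by apply: bopP => F; apply: cfun_inj => x; rewrite /= smulA. Qed.

Definition trace_vector : H := embed h I.

Lemma left_op_embed u x : left_op u (embed h x) = embed h (u ** x).
Proof. exact: lift_embed. Qed.

Lemma right_op_embed u x : right_op u (embed h x) = embed h (x ** u).
Proof. exact: lift_embed. Qed.

Lemma trace_vector_state : is_state trace_vector.
Proof.
have : `|trace_vector| ^+ 2 = 1 ^+ 2.
  by rewrite -cdot_norm cdot_embed /= /gns_form adj1 smul1r tfun1 expr1n.
by move/eqP; rewrite eqrXn2 ?normr_ge0// => /eqP.
Qed.

End TracialFunctionals.

Section WeakOperatorTopology.
Context {R : realType} {H : hilbertType R}.
Local Notation C := R[i].

Lemma matrix_coef_continuous (a b : H) :
  continuous ((fun T : bop H => hdot (T a) b) : @wot R H -> C^o).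
Proof.
move=> T.
apply: (@continuous_comp (@wot R H) {ptws H * H -> C^o} C^o
  (@matrix_coef R H) (@^~ (a, b))).
  exact: initial_continuous.
exact: (@proj_continuous (H * H)%type (fun _ => C^o) (a, b)).
Qed.

Lemma hdotBl (x y z : H) : hdot (x - y) z = hdot x z - hdot y z.
Proof. exact: linearBl. Qed.

Lemma bop_near (T : bop H) (x : H) (e : C) : 0 < e ->
  exists2 d, 0 < d & forall y, `|x - y| < d -> `|T x - T y| < e.
Proof.
move=> e0; move/cvgrPdist_lt: (@bop_continuous R H T x) => /(_ _ e0).
move=> /nbhs_ballP[d /= d0 dT]; exists d => // y xy; apply: dT.
by rewrite -ball_normE.
Qed.

Lemma wot_closure_coef (W : set (bop H)) (T : bop H) (a b c d : H) :
  (forall S, W S -> hdot (S a) b = hdot (S c) d) ->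
  @closure (@wot R H) W T -> hdot (T a) b = hdot (T c) d.
Proof.
move=> WE TW; apply/eqP; rewrite -subr_eq0 -normr_eq0; apply/eqP.
apply: le_all_pos_eq0 => // e e0; have e2 : 0 < e / 2 by rewrite divr_gt0.
have near_coef x y : nbhs (T : @wot R H)
    [set S : bop H | `|hdot (T x) y - hdot (S x) y| < e / 2].
  by move/cvgrPdist_lt: (@matrix_coef_continuous x y T) => /(_ _ e2).
have [S [WS [Sab Scd]]] := TW _ (filterI (near_coef a b) (near_coef c d)).
have -> : hdot (T a) b - hdot (T c) d =
    (hdot (T a) b - hdot (S a) b) - (hdot (T c) d - hdot (S c) d).
  by rewrite (WE S WS); ring.
by rewrite (le_trans (ler_normB _ _))// [e]splitr lerD// ltW.
Qed.

End WeakOperatorTopology.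

Section TracialCommutant.
Context {R : realType} {U : lmodType R[i]} {S : star_algebra U}.
Variable phi : tracial_functional S.
Hypothesis phi_bounded : forall v, mul_bounded phi v.
Local Notation C := R[i].
Local Notation h := (gns_dot phi).
Local Notation H := (completion h).
Local Notation rop := (right_op phi_bounded).
Local Notation psi := (trace_vector phi).
Implicit Types (T : bop H).

Definition right_commutant : set (bop H) :=
  [set T | forall v, T * rop v = rop v * T].

Lemma right_commutantP T : right_commutant T <->
  forall v (x y : H), hdot (T (rop v x)) y = hdot (T x) (rop (adj S v) y).
Proof.
split=> [Tv v x y|Tv v].
  by rewrite -right_op_adjoint -[LHS]/(hdot ((T * rop v) x) y) Tv.
apply: bopP => x; apply/eqP; rewrite -subr_eq0; apply/eqP.
apply: cdot_definite; rewrite -completion_hdotE.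
set z := (X in hdot X X); rewrite {1}/z hdotBl /=.
by rewrite Tv -right_op_adjoint subrr.
Qed.

Lemma right_commutant_vna : von_neumann_algebra right_commutant.
Proof.
split.
- by move=> v; rewrite mul1r mulr1.
- move=> c T T' Tv T'v v.
  by rewrite mulrDl mulrDr -bop_scalerAl -bop_scalerAr Tv T'v.
- by move=> T T' Tv T'v v; rewrite -mulrA T'v !mulrA Tv.
- move=> T T' Tv TT'; apply/right_commutantP => v x y.
  have TT'' a b : hdot (T' a) b = hdot a (T b).
    by rewrite completion_hdotE cdotC -completion_hdotE -TT' completion_hdotE -cdotC.
  rewrite TT'' right_op_adjoint TT''.
  by rewrite -[T (_ y)]/((T * rop (adj S v)) y) Tv.
- move=> T TW; apply/right_commutantP => v x y.
  by apply: wot_closure_coef TW => T' /right_commutantP T'v.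
Qed.

Lemma left_op_commutant u : right_commutant (left_op phi_bounded u).
Proof. by move=> v; apply: left_right_comm. Qed.

Lemma hdot_embed_clim (T : bop H) (u : nat -> U) (F y : H) :
  represents h u F -> clim (fun n => hdot (T (embed h (u n))) y) (hdot (T F) y).
Proof.
move=> uF e e0; pose c : C := `|y| + 1.
have c0 : 0 < c by rewrite ltr_wpDl.
have [d d0 dT] := bop_near T F (divr_gt0 e0 c0).
have [N Nd] := embed_approx uF (divr_gt0 d0 (ltr0n C 2)); exists N => n Nn.
have {}dT : `|T F - T (embed h (u n))| < e / c.
  apply: dT; rewrite completion_normE.
  by apply: le_lt_trans (Nd _ Nn) _; rewrite ltr_pdivrMr// ltr_pMr// ltr1n.
rewrite -hdotBl completion_hdotE.
apply: (le_lt_trans (@sdot_CS _ _ (completion_dot h) _ _)).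
rewrite -!completion_normE; move: dT; rewrite ltr_pdivlMr//.
by apply: le_lt_trans; rewrite ler_wpM2l// lerDl.
Qed.

(* If [u n] tends to [F], then [T F = lim T R_(u n) psi = lim R_(u n) T psi]. *)
Lemma commutant_coef_clim T (u : nat -> U) (F : H) : right_commutant T ->
  represents h u F -> clim (fun n => (T psi) (adj S (u n))) (hdot (T F) psi).
Proof.
move=> TW uF e e0; have [N uN] := hdot_embed_clim T psi uF e0; exists N => n Nn.
rewrite (_ : T psi _ = hdot (T (embed h (u n))) psi); first exact: uN.
move/right_commutantP: TW => TW.
rewrite -[u n in RHS](smul1l S) -(right_op_embed phi_bounded) TW.
by rewrite right_op_embed smul1l completion_hdotE cdot_embed.
Qed.

Lemma commutant_trace T T' : right_commutant T -> right_commutant T' ->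
  expect (T * T') psi = expect (T' * T) psi.
Proof.
move=> TW T'W; have [uF vG] := (approxP (T psi), approxP (T' psi)).
set u := approx _ in uF; set v := approx _ in vG.
have adjC w : vcauchy h w -> vcauchy h (fun n => adj S (w n)).
  move=> wC e /wC[N wN]; exists N => n m Nn Nm.
  have -> : adj S (w n) - adj S (w m) = adj S (w n - w m).
    by rewrite addrC -scaleN1r -[-1](rmorphN1 Num.conj) -adjP scaleN1r addrC.
  by rewrite /snorm gns_form_star; apply: wN.
have [l ul] := sdot_cauchy_cvg uF.1 (adjC _ vG.1).
have -> : expect (T * T') psi = l.
  apply: clim_unique (commutant_coef_clim TW vG) _.
  exact: represents_cvg uF (adjC _ vG.1) ul.
have vl : clim (fun n => h (v n) (adj S (u n))) l.
  move=> e /ul[N uN]; exists N => n /uN.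
  by rewrite /= /gns_form !adjK tfun_trace.
apply/esym; apply: clim_unique (commutant_coef_clim T'W uF) _.
exact: represents_cvg vG (adjC _ uF.1) vl.
Qed.

Lemma right_commutant_tracial :
  tracial_von_neumann_algebra right_commutant (fun T => expect T psi).
Proof.
split; first exact: right_commutant_vna.
- by move=> c T T' _ _; rewrite /expect linearDl linearZl.
- exact: commutant_trace.
- move=> T T' TW TT'; rewrite /expect -[hdot _ _]/(hdot (T' (T psi)) psi).
  rewrite completion_hdotE cdotC -completion_hdotE -TT' completion_hdotE -cdotC.
  exact: cdot_ge0.
- by rewrite /expect completion_hdotE cdot_norm trace_vector_state expr1n.
Qed.

End TracialCommutant.

(** * Projective measurements *)

Section ProjectiveMeasurements.
Context {R : realType} {U : lmodType R[i]} (S : star_algebra U).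
Local Notation C := R[i].
Local Notation "u ** v" := (smul S u v) (at level 40, left associativity).
Implicit Types (I J K : finType).

Definition star_pvm I J (p : I -> J -> U) :=
  [/\ forall i j k, p i j ** p i k = if j == k then p i j else 0,
      forall i, \sum_j p i j = sone S &
      forall i j, adj S (p i j) = p i j].

Lemma coarse_pvm I I' J K (p : I -> J -> U) (s : I' -> I) (r : I' -> J -> K -> bool) :
  star_pvm p ->
  (forall i j k k', k != k' -> ~~ (r i j k && r i j k')) ->
  (forall i j, exists k, r i j k) ->
  star_pvm (fun i k => \sum_(j | r i j k) p (s i) j).
Proof.
move=> [pp p1 padj] runique rex; split=> [i k k'|i|i k].
- have inner j : \sum_(j' | r i j' k') p (s i) j ** p (s i) j' =
      if r i j k' then p (s i) j else 0.
    rewrite big_mkcond (bigD1 j)//= pp eqxx big1 ?addr0// => j' j'j.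
    by rewrite pp eq_sym (negbTE j'j); case: ifP.
  rewrite smul_suml; under eq_bigr do rewrite smul_sumr inner.
  have [<-|kk'] := eqVneq k k'; first by apply: eq_bigr => j ->.
  apply: big1 => j rjk; have := runique i j _ _ kk'.
  by rewrite rjk /= => /negbTE ->.
- rewrite -(p1 (s i)); under eq_bigr do rewrite big_mkcond.
  rewrite exchange_big; apply: eq_bigr => j _ /=.
  have [k rjk] := rex i j; rewrite (bigD1 k)//= rjk big1 ?addr0// => k' k'k.
  by have := runique i j _ _ k'k; rewrite rjk andbT => /negbTE ->.
- rewrite (big_morph (adj S) (adjD S) (adj0 S)).
  by apply: eq_bigr => j _; apply: padj.
Qed.

(* Multiply by the unit [\sum_j p j] on the left, or [\sum_k q k] on the right:
   the compatible pairs [(j, k)] are the only ones that survive. *)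
Lemma marginal J K (V : zmodType) (E : U -> V) (p : J -> U) (q : K -> U)
    (r : J -> K -> bool) :
  (forall u v, E (u + v) = E u + E v) ->
  \sum_j p j = sone S -> \sum_k q k = sone S ->
  (forall j k, ~~ r j k -> E (p j ** q k) = 0) ->
  (forall j k k', k != k' -> ~~ (r j k && r j k')) ->
  forall k, E (\sum_(j | r j k) p j) = E (q k).
Proof.
move=> ED p1 q1 E0 runique k.
have Ez : E 0 = 0 by apply: (addIr (E 0)); rewrite -ED !add0r.
have Esum := big_morph E ED Ez.
rewrite -[q k](smul1l S) -p1 smul_suml !Esum [RHS](bigID (r ^~ k))/=.
rewrite [X in _ + X]big1 ?addr0; last by move=> j; apply: E0.
apply: eq_bigr => j rjk; rewrite -[p j in LHS](smul1r S) -q1 smul_sumr Esum.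
rewrite (bigD1 k)//= big1 ?addr0// => k' k'k; apply: E0.
by have := runique j _ _ k'k; rewrite rjk andbT.
Qed.

Section NullElements.
Variable phi : tracial_functional S.
Hypothesis phi_bounded : forall v, mul_bounded phi v.
Local Notation h := (gns_dot phi).
Local Notation lop := (left_op phi_bounded).
Local Notation rop := (right_op phi_bounded).

Lemma cfun0 w : (0 : completion h) w = 0.
Proof. exact: (sdot0l h). Qed.

Lemma embedD u v : embed h (u + v) = embed h u + embed h v.
Proof. by have := embed_linear h 1 u v; rewrite !scale1r. Qed.

Lemma embed_eq0 u : h u u = 0 -> embed h u = 0.
Proof. by move=> u0; apply: cdot_definite; rewrite cdot_embed. Qed.

Lemma projection_product_null p q : adj S p = p -> adj S q = q ->
  p ** p = p -> q ** q = q -> phi (p ** q) = 0 -> embed h (p ** q) = 0.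
Proof.
move=> ap aq pp qq pq0; apply: embed_eq0.
rewrite /= /gns_form adjM ap aq smulA -[q ** p ** p]smulA pp tfun_trace smulA qq.
by rewrite tfun_trace.
Qed.

Lemma embed0 : embed h 0 = 0.
Proof. by apply: embed_eq0; rewrite sdot0l. Qed.

Lemma left_op_null u : embed h u = 0 -> lop u = 0.
Proof.
move=> u0; apply: bopP => F; apply: cfun_inj => w.
have au0 : embed h (adj S u) = 0.
  by apply: embed_eq0; rewrite gns_form_star -[LHS]/(embed h u u) u0 cfun0.
rewrite liftE -cdot_embed -(right_op_embed phi_bounded) au0 bop0.
have -> : cdot F 0 = 0 := sdot0r (completion_dot h) F.
by rewrite cfun0.
Qed.

Lemma left_opD u v : lop (u + v) = lop u + lop v.
Proof. by have := left_op_linear phi_bounded 1 u v; rewrite !scale1r. Qed.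

Lemma right_opD u v : rop (u + v) = rop u + rop v.
Proof. by have := right_op_linear phi_bounded 1 u v; rewrite !scale1r. Qed.

Lemma left_op_sum J (P : pred J) (F : J -> U) :
  lop (\sum_(j | P j) F j) = \sum_(j | P j) lop (F j).
Proof. by rewrite (big_morph _ left_opD (left_op_null embed0)). Qed.

Lemma right_op0 : rop 0 = 0.
Proof. by apply: (addIr (rop 0)); rewrite -right_opD !add0r. Qed.

Lemma left_op_pvm I J (p : I -> J -> U) : star_pvm p -> pvm (fun i j => lop (p i j)).
Proof.
move=> [pp p1 _]; split=> [i j k|i]; last by rewrite -left_op_sum p1 left_op1.
by rewrite -left_opM pp; case: eqP => // _; rewrite (left_op_null embed0).
Qed.

Lemma right_op_pvm I J (p : I -> J -> U) : star_pvm p -> pvm (fun i j => rop (p i j)).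
Proof.
move=> [pp p1 _]; split=> [i j k|i].
  by rewrite -right_opM pp eq_sym; case: eqP => [->|_]; rewrite ?right_op0.
by rewrite -(big_morph _ right_opD right_op0) p1 right_op1.
Qed.

End NullElements.
End ProjectiveMeasurements.

(** * Mirror games *)

Section MirrorGame.
Context {R : realType} {X Y A B : finType}.
Local Notation C := R[i].
Local Notation U := (game_alg R[i] X Y A B).
Local Notation D1 := (@game_alg1 C X Y A B).
Local Notation D2 := (@game_alg2 C X Y A B).
Implicit Types (u v w : U) (c : C).

Lemma e1_pvm : pvm (@e1 C X Y A B).
Proof.
split=> [x a a'|x].
  have [<-|n] := eqVneq; rewrite /e1 -[LHS]to_quotM.
    by rewrite -expr2; apply/to_quotP; apply: sub_gen_smallest; apply: game_idem1.
  rewrite -[RHS]/(to_quot _ 0); apply/to_quotP; rewrite subr0.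
  by apply: sub_gen_smallest; apply: game_orth1.
rewrite /e1 -(big_morph _ (to_quotD _) erefl) -[RHS]/(to_quot _ 1).
by apply/to_quotP; apply: sub_gen_smallest; apply: game_sum1.
Qed.

Lemma e2_pvm : pvm (@e2 C X Y A B).
Proof.
split=> [y b b'|y].
  have [<-|n] := eqVneq; rewrite /e2 -[LHS]to_quotM.
    by rewrite -expr2; apply/to_quotP; apply: sub_gen_smallest; apply: game_idem2.
  rewrite -[RHS]/(to_quot _ 0); apply/to_quotP; rewrite subr0.
  by apply: sub_gen_smallest; apply: game_orth2.
rewrite /e2 -(big_morph _ (to_quotD _) erefl) -[RHS]/(to_quot _ 1).
by apply/to_quotP; apply: sub_gen_smallest; apply: game_sum2.
Qed.

Lemma e12_comm x a y b : e1 x a * e2 y b = e2 y b * e1 x a :> U.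
Proof.
rewrite /e1 /e2 -[LHS]to_quotM -[RHS]to_quotM; apply/to_quotP.
by apply: sub_gen_smallest; apply: game_comm.
Qed.

Lemma game_mulPl c u v w : (c *: u + v) * w = c *: (u * w) + v * w.
Proof. by rewrite mulrDl -[c *: u * w]quot_scalerAl. Qed.

Lemma game_mulPr c u v w : w * (c *: u + v) = c *: (w * u) + w * v.
Proof. by rewrite mulrDr -[w * (c *: u)]quot_scalerAr. Qed.

Lemma game_starP c u v : star (c *: u + v) = c^* *: star u + star v.
Proof. by rewrite starD starZ. Qed.

Definition game_star_algebra : star_algebra U :=
  @StarAlgebra R U *%R 1 (@star C X Y A B) (@mulrA U) (@mul1r U) (@mulr1 U)
    game_mulPl game_mulPr (@starK C X Y A B) game_starP (@starM C X Y A B).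

Local Notation S := game_star_algebra.

Lemma game_mul_bounded (phi : tracial_functional S) v : mul_bounded phi v.
Proof.
apply: game_alg_ind.
- split; [exact: mul_bounded1|exact: mul_bounded_linear|exact: mul_boundedM].
- move=> x a; apply: projection_mul_bounded; first exact: star_e1.
  by rewrite -[LHS]/(e1 x a * e1 x a) e1_pvm.1 eqxx.
- move=> y b; apply: projection_mul_bounded; first exact: star_e2.
  by rewrite -[LHS]/(e2 y b * e2 y b) e2_pvm.1 eqxx.
Qed.

Lemma e1_star_pvm : star_pvm S (@e1 C X Y A B).
Proof. by split; [exact: e1_pvm.1|exact: e1_pvm.2|exact: star_e1]. Qed.

Lemma e2_star_pvm : star_pvm S (@e2 C X Y A B).
Proof. by split; [exact: e2_pvm.1|exact: e2_pvm.2|exact: star_e2]. Qed.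

Lemma subalgebra_gen_subalgebra (P : set U) : subalgebra (subalgebra_gen P).
Proof.
split.
- by move=> D [[]].
- by move=> c u v uD vD D DP; have [[_ L _] _] := DP; apply: L; [apply: uD|apply: vD].
- by move=> u v uD vD D DP; have [[_ _ M] _] := DP; apply: M; [apply: uD|apply: vD].
Qed.

Lemma subalgebra0 (D : set U) : subalgebra D -> D 0.
Proof.
move=> [D1' DL _]; by rewrite -(addNr (1 : U)) -scaleN1r; apply: DL.
Qed.

Lemma subalgebraD (D : set U) u v : subalgebra D -> D u -> D v -> D (u + v).
Proof. by move=> [_ DL _] uD vD; rewrite -[u]scale1r; apply: DL. Qed.

Lemma subalgebra_sum (D : set U) (J : finType) (P : pred J) (F : J -> U) :
  subalgebra D -> (forall j, D (F j)) -> D (\sum_(j | P j) F j).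
Proof.
move=> Dsub DF; elim/big_ind: _ => [|u v uD vD|j _]; last exact: DF.
  exact: subalgebra0.
exact: subalgebraD.
Qed.

Lemma game_alg1_e1 x a : D1 (e1 x a).
Proof. by apply: sub_gen_smallest; exists x, a. Qed.

Lemma game_alg2_e2 y b : D2 (e2 y b).
Proof. by apply: sub_gen_smallest; exists y, b. Qed.

Section StarRep.
Context {H : hilbertType R} (D : set U) (pi : U -> bop H).
Hypotheses (Dsub : subalgebra D) (pi_rep : star_rep D pi).

Lemma star_repD u v : D u -> D v -> pi (u + v) = pi u + pi v.
Proof.
by move=> uD vD; have [_ piL _ _] := pi_rep; rewrite -[u]scale1r piL// !scale1r.
Qed.

Lemma star_rep0 : pi 0 = 0.
Proof.
apply: (addIr (pi 0)); rewrite add0r -star_repD ?addr0//; exact: subalgebra0.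
Qed.

Lemma star_rep_sum (J : finType) (P : pred J) (F : J -> U) :
  (forall j, D (F j)) -> pi (\sum_(j | P j) F j) = \sum_(j | P j) pi (F j).
Proof.
move=> DF.
suff [] : D (\sum_(j | P j) F j) /\
    pi (\sum_(j | P j) F j) = \sum_(j | P j) pi (F j) by [].
elim/big_ind2: _ => [|u T v T' [uD <-] [vD <-]|j _]; last by split.
  by split; [apply: subalgebra0|apply: star_rep0].
by split; [apply: subalgebraD|apply: star_repD].
Qed.

Lemma star_rep_pvm (I J : finType) (p : I -> J -> U) : (forall i j, D (p i j)) ->
  star_pvm S p -> pvm (fun i j => pi (p i j)).
Proof.
move=> Dp [pp p1 _]; have [pi1 _ piM _] := pi_rep; split=> [i j k|i].
  rewrite -piM// (_ : p i j * p i k = if j == k then p i j else 0); last exact: pp.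
  by case: ifP => // _; apply: star_rep0.
by rewrite -star_rep_sum// (_ : \sum_j p i j = 1) //; apply: p1.
Qed.

End StarRep.

Lemma subalgebraT : subalgebra [set: U].
Proof. by []. Qed.

Lemma star_repS {H : hilbertType R} (D : set U) (pi : U -> bop H) :
  star_rep setT pi -> star_rep D pi.
Proof.
move=> [pi1 piL piM piA]; split=> //.
- by move=> *; apply: piL.
- by move=> *; apply: piM.
- by move=> *; apply: piA.
Qed.

Definition point_pvm {H : hilbertType R} {I J : finType} (j0 : J) (_ : I) (j : J) : bop H :=
  if j == j0 then 1 else 0.

Lemma point_pvmP {H : hilbertType R} {I J : finType} (j0 : J) :
  pvm (@point_pvm H I J j0).
Proof.
rewrite /point_pvm; split=> [_ j k|_]; last first.
  by rewrite (bigD1 j0)//= eqxx big1 ?addr0// => j /negbTE ->.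
have [->|jk] := eqVneq j k; first by case: ifP; rewrite ?mulr1 ?mulr0.
have [jj0|] := eqVneq j j0; last by rewrite mul0r.
by rewrite -jj0 eq_sym (negbTE jk) mulr0.
Qed.

Lemma point_pvm_adjoint {H : hilbertType R} {I J : finType} (j0 : J) (i : I) j :
  is_adjoint (@point_pvm H I J j0 i j) (point_pvm j0 i j).
Proof.
move=> x y; rewrite /point_pvm; case: ifP => // _ /=.
by rewrite linear0l linear0r.
Qed.

Lemma point_pvm_comm {H : hilbertType R} {I J : finType} (j0 : J) (i : I) j T :
  @point_pvm H I J j0 i j * T = T * point_pvm j0 i j.
Proof.
by rewrite /point_pvm; case: ifP; rewrite ?mulr1 ?mul1r// ?mulr0 ?mul0r.
Qed.

Lemma star_rep_extend {H : hilbertType R} (G : set U) (pi pi' : U -> bop H) :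
  star_rep (subalgebra_gen G) pi -> star_rep setT pi' ->
  (forall u, G u -> pi' u = pi u) ->
  (forall x a, exists2 v, subalgebra_gen G v & pi' (e1 x a) = pi v) ->
  (forall y b, exists2 v, subalgebra_gen G v & pi' (e2 y b) = pi v) ->
  (forall u, subalgebra_gen G u -> pi' u = pi u) /\
  (forall u, exists2 v, subalgebra_gen G v & pi' u = pi v).
Proof.
move=> piR pi'R piG pi1 pi2; have Dsub := subalgebra_gen_subalgebra G.
have [D_1 DL DM] := Dsub; have [pi_1 piL piM _] := piR; have [pi'_1 pi'L pi'M _] := pi'R.
split.
- have : subalgebra_gen G `<=` [set u | subalgebra_gen G u /\ pi' u = pi u].
    apply: smallest_sub; last first.
      by move=> u Gu; split; [apply: sub_gen_smallest|apply: piG].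
    split=> /=.
    + by split=> //; rewrite pi_1 pi'_1.
    + move=> c u v [uD ue] [vD ve]; split; first exact: DL.
      by rewrite pi'L// piL// ue ve.
    + move=> u v [uD ue] [vD ve]; split; first exact: DM.
      by rewrite pi'M// piM// ue ve.
  by move=> DE u /DE[].
- apply: (@game_alg_ind R X Y A B [set u | exists2 v, subalgebra_gen G v & pi' u = pi v]) => //.
  split=> /=.
  + by exists 1; [|rewrite pi_1 pi'_1].
  + move=> c u v [u' uD ue] [v' vD ve]; exists (c *: u' + v'); first exact: DL.
    by rewrite pi'L// piL// ue ve.
  + move=> u v [u' uD ue] [v' vD ve]; exists (u' * v'); first exact: DM.
    by rewrite pi'M// piM// ue ve.
Qed.

Lemma star_rep_extend1 {H : hilbertType R} (pi : U -> bop H) : (0 < #|B|)%N ->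
  star_rep D1 pi -> exists pi' : U -> bop H, [/\ star_rep setT pi',
    forall u, D1 u -> pi' u = pi u & forall u, exists2 v, D1 v & pi' u = pi v].
Proof.
move=> /card_gt0P[b0 _] piR; have D1sub : subalgebra D1 := subalgebra_gen_subalgebra _.
have [_ _ _ piA] := piR.
have p1 := star_rep_pvm D1sub piR game_alg1_e1 e1_star_pvm.
have p2 := @point_pvmP H Y B b0.
have p12 x a (y : Y) b :
    pi (e1 x a) * point_pvm b0 y b = point_pvm b0 y b * pi (e1 x a).
  by rewrite point_pvm_comm.
have adj1 x a : is_adjoint (pi (e1 x a)) (pi (e1 x a)).
  by rewrite -{2}[e1 x a]star_e1; apply: piA; apply: game_alg1_e1.
have R' := game_lift_rep p1 p2 p12 adj1 (@point_pvm_adjoint H Y B b0).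
have E1 := game_lift_e1 p1 p2 p12; have E2 := game_lift_e2 p1 p2 p12.
set pi' := game_lift _ _ in R' E1 E2; exists pi'.
have [||| DE DI] := star_rep_extend piR R'; last by split.
- by move=> _ [x [a ->]]; apply: E1.
- by move=> x a; exists (e1 x a); [apply: game_alg1_e1|apply: E1].
- move=> y b; rewrite E2 /point_pvm; case: ifP => _.
    by exists 1; [have [] := D1sub|have [->] := piR].
  by exists 0; [apply: subalgebra0|rewrite (star_rep0 D1sub piR)].
Qed.

Lemma star_rep_extend2 {H : hilbertType R} (pi : U -> bop H) : (0 < #|A|)%N ->
  star_rep D2 pi -> exists pi' : U -> bop H, [/\ star_rep setT pi',
    forall u, D2 u -> pi' u = pi u & forall u, exists2 v, D2 v & pi' u = pi v].
Proof.
move=> /card_gt0P[a0 _] piR; have D2sub : subalgebra D2 := subalgebra_gen_subalgebra _.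
have [_ _ _ piA] := piR.
have p1 := @point_pvmP H X A a0.
have p2 := star_rep_pvm D2sub piR game_alg2_e2 e2_star_pvm.
have p12 (x : X) a y b :
    point_pvm a0 x a * pi (e2 y b) = pi (e2 y b) * point_pvm a0 x a.
  by rewrite point_pvm_comm.
have adj2 y b : is_adjoint (pi (e2 y b)) (pi (e2 y b)).
  by rewrite -{2}[e2 y b]star_e2; apply: piA; apply: game_alg2_e2.
have R' := game_lift_rep p1 p2 p12 (@point_pvm_adjoint H X A a0) adj2.
have E1 := game_lift_e1 p1 p2 p12; have E2 := game_lift_e2 p1 p2 p12.
set pi' := game_lift _ _ in R' E1 E2; exists pi'.
have [||| DE DI] := star_rep_extend piR R'; last by split.
- by move=> _ [y [b ->]]; apply: E2.
- move=> x a; rewrite E1 /point_pvm; case: ifP => _.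
    by exists 1; [have [] := D2sub|have [->] := piR].
  by exists 0; [apply: subalgebra0|rewrite (star_rep0 D2sub piR)].
- by move=> y b; exists (e2 y b); [apply: game_alg2_e2|apply: E2].
Qed.

Section TracialRepresentation.
Context {H : hilbertType R} (W : set (bop H)) (tau : bop H -> C) (pi : U -> bop H).
Hypotheses (pi_rep : star_rep setT pi) (piW : forall u, W (pi u)).
Hypotheses (tauL : linear_functional W tau) (tauT : tracial W tau).
Hypotheses (tauP : positive_functional W tau) (tau1 : tau 1 = 1).

Lemma trace_rep_linear c u v : tau (pi (c *: u + v)) = c * tau (pi u) + tau (pi v).
Proof. by have [_ piL _ _] := pi_rep; rewrite piL// tauL. Qed.

Lemma trace_rep_trace u v : tau (pi (u * v)) = tau (pi (v * u)).
Proof.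
have [_ _ piM _] := pi_rep.
have E w z : tau (pi (w * z)) = tau (pi w * pi z) by rewrite piM.
exact: etrans (E u v) (etrans (tauT (piW u) (piW v)) (esym (E v u))).
Qed.

Lemma trace_rep_ge0 u : 0 <= tau (pi (star u * u)).
Proof.
by have [_ _ piM piA] := pi_rep; rewrite piM//; apply: tauP => //; apply: piA.
Qed.

Lemma trace_rep1 : tau (pi 1) = 1.
Proof. by have [-> _ _ _] := pi_rep. Qed.

Definition trace_rep : tracial_functional S :=
  @TracialFunctional R U S (tau \o pi) trace_rep_linear trace_rep_trace
    trace_rep_ge0 trace_rep1.

End TracialRepresentation.

End MirrorGame.

Section VectorState.
Context {R : realType} {H : hilbertType R} (psi : H).
Hypothesis psi_state : is_state psi.

Lemma expect_linear (W : set (bop H)) : linear_functional W (fun T => expect T psi).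
Proof. by move=> c S T _ _; rewrite /expect linearDl linearZl. Qed.

Lemma hdotC (x y : H) : hdot x y = (hdot y x)^*.
Proof. by have := @hermitian_subproof _ _ _ _ hdot x y; rewrite mul1r. Qed.

Lemma expect_positive (W : set (bop H)) : positive_functional W (fun T => expect T psi).
Proof.
move=> T T' _ TT'; rewrite /expect -[hdot _ _]/(hdot (T' (T psi)) psi).
by rewrite hdotC -TT' -hdotC hdot_norm exprn_ge0.
Qed.

Lemma expect1 : expect 1 psi = 1.
Proof. by rewrite /expect hdot_norm psi_state expr1n. Qed.

End VectorState.

Section Conditions.
Context {R : realType} {X Y A B : finType} (lam : X -> Y -> A -> B -> bool).
Context (xi : X -> Y) (eta : Y -> X).
Hypotheses (X_gt0 : (0 < #|X|)%N) (Y_gt0 : (0 < #|Y|)%N).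
Hypotheses (A_gt0 : (0 < #|A|)%N) (B_gt0 : (0 < #|B|)%N).
Hypotheses (lam_mirror : mirror_game lam xi eta) (lam_regular : regular_game lam xi eta).
Local Notation C := R[i].
Local Notation U := (game_alg R[i] X Y A B).
Local Notation D1 := (@game_alg1 C X Y A B).
Local Notation D2 := (@game_alg2 C X Y A B).
Local Notation S := (@game_star_algebra R X Y A B).
Implicit Types (u v w : U).

Definition mirror_trace := exists (phi : tracial_functional S)
    (p : X -> A -> U) (q : Y -> B -> U),
  [/\ star_pvm S p, star_pvm S q &
      forall x y a b, ~~ lam x y a b -> phi (p x a * q y b) = 0].

Lemma mirror_f_pvm : star_pvm S (@mirror_f R X Y A B lam eta).
Proof.
apply: (@coarse_pvm R U S X Y A B e1 eta (fun y a b => lam (eta y) y a b)).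
- exact: e1_star_pvm.
- by move=> y a b b'; apply: lam_mirror.2.
- move=> y a; have /setP/(_ a) := lam_regular.2 y.
  by rewrite finset.in_setT => /finset.bigcupP[b _]; rewrite finset.in_set => ?; exists b.
Qed.

Lemma mirror_g_pvm : star_pvm S (@mirror_g R X Y A B lam xi).
Proof.
apply: (@coarse_pvm R U S Y X B A e2 xi (fun x b a => lam x (xi x) a b)).
- exact: e2_star_pvm.
- by move=> x b a a'; apply: lam_mirror.1.
- move=> x b; have /setP/(_ b) := lam_regular.1 x.
  by rewrite finset.in_setT => /finset.bigcupP[a _]; rewrite finset.in_set => ?; exists a.
Qed.

Lemma mirror_trace1 (H : hilbertType R) (W : set (bop H)) tau (pi : U -> bop H) :
  star_rep D1 pi -> pi @` D1 `<=` W ->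
  linear_functional W tau -> tracial W tau -> positive_functional W tau ->
  tau 1 = 1 ->
  (forall x y a b, ~~ lam x y a b -> tau (pi (e1 x a * mirror_f R lam eta y b)) = 0) ->
  mirror_trace.
Proof.
move=> piR piW tauL tauT tauP tau1 tau0.
have [pi' [pi'R pi'E pi'I]] := star_rep_extend1 B_gt0 piR.
have pi'W u : W (pi' u) by have [v vD ->] := pi'I u; apply: piW; exists v.
exists (trace_rep pi'R pi'W tauL tauT tauP tau1), e1, (mirror_f R lam eta).
split; [exact: e1_star_pvm|exact: mirror_f_pvm|move=> x y a b xyab].
rewrite /= pi'E ?tau0//; have D1sub : subalgebra D1 := subalgebra_gen_subalgebra _.
have [_ _ D1M] := D1sub; apply: D1M; first exact: game_alg1_e1.
by apply: subalgebra_sum => // a'; apply: game_alg1_e1.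
Qed.

Lemma mirror_trace2 (H : hilbertType R) (W : set (bop H)) tau (pi : U -> bop H) :
  star_rep D2 pi -> pi @` D2 `<=` W ->
  linear_functional W tau -> tracial W tau -> positive_functional W tau ->
  tau 1 = 1 ->
  (forall x y a b, ~~ lam x y a b -> tau (pi (e2 y b * mirror_g R lam xi x a)) = 0) ->
  mirror_trace.
Proof.
move=> piR piW tauL tauT tauP tau1 tau0.
have [pi' [pi'R pi'E pi'I]] := star_rep_extend2 A_gt0 piR.
have pi'W u : W (pi' u) by have [v vD ->] := pi'I u; apply: piW; exists v.
exists (trace_rep pi'R pi'W tauL tauT tauP tau1), (mirror_g R lam xi), e2.
split; [exact: mirror_g_pvm|exact: e2_star_pvm|move=> x y a b xyab].
apply: etrans (tfun_trace (trace_rep pi'R pi'W tauL tauT tauP tau1) _ _) _.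
rewrite /= pi'E ?tau0//; have D2sub : subalgebra D2 := subalgebra_gen_subalgebra _.
have [_ _ D2M] := D2sub; apply: D2M; first exact: game_alg2_e2.
by apply: subalgebra_sum => // b'; apply: game_alg2_e2.
Qed.

Lemma ideal_gen_kill (H : hilbertType R) (D P : set U) (pi : U -> bop H) :
  subalgebra D -> star_rep setT pi -> P `<=` D -> (forall u, P u -> pi u = 0) ->
  pi @` ideal_gen D P = [set 0].
Proof.
move=> Dsub piR PD piP.
have [D_1 DL DM] := Dsub; have [_ _ piM _] := piR.
have pi0 := star_rep0 subalgebraT piR.
have I0 : ideal_gen D P `<=` [set u | D u /\ pi u = 0].
  apply: smallest_sub; last by move=> u Pu; split; [apply: PD|apply: piP].
  split=> /=.
  - by move=> u [].
  - by split=> //; apply: subalgebra0.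
  - move=> u v [uD u0] [vD v0]; split; first exact: subalgebraD.
    by rewrite (star_repD piR)// u0 v0 addr0.
  - move=> u v uD [vD v0]; split; first exact: DM.
    by rewrite piM// v0 mulr0.
  - move=> u v [uD u0] vD; split; first exact: DM.
    by rewrite piM// u0 mul0r.
apply/seteqP; split=> [_ [u /I0[_ u0] <-]|_ ->]; first exact: u0.
exists 0; last exact: pi0.
by move=> J [[_ J0 _ _ _] _].
Qed.

Definition tracial_model (D I : set U) :=
  exists (H : hilbertType R) (W : set (bop H)) (psi : H) (pi : U -> bop H),
    [/\ tracial_von_neumann_algebra W (fun T => expect T psi), is_state psi,
        star_rep D pi, pi @` D `<=` W & pi @` I = [set 0]].

Lemma mirror_trace_model1 : mirror_trace -> tracial_model D1 (mir1 lam eta).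
Proof.
move=> [phi [p [q [p_pvm q_pvm pq0]]]].
have bdd := game_mul_bounded phi; have /card_gt0P[b0 _] := B_gt0.
have [pp p1 padj] := p_pvm; have [qq q1 qadj] := q_pvm.
have L1 := left_op_pvm bdd p_pvm.
have L2 := point_pvmP (H := completion (gns_dot phi)) (I := Y) b0.
have L12 x a (y : Y) b : left_op bdd (p x a) * point_pvm b0 y b =
    point_pvm b0 y b * left_op bdd (p x a) by rewrite point_pvm_comm.
have adj1 x a : is_adjoint (left_op bdd (p x a)) (left_op bdd (p x a)).
  by rewrite -{2}[p x a]padj; apply: left_op_adjoint.
have piR := game_lift_rep L1 L2 L12 adj1 (point_pvm_adjoint b0).
have E1 := game_lift_e1 L1 L2 L12; have E2 := game_lift_e2 L1 L2 L12.
set pi := game_lift _ _ in piR E1 E2.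
have Wtr := right_commutant_tracial bdd.
have [[W1 WL WM _ _] _ _ _ _] := Wtr.
exists (completion (gns_dot phi)), (right_commutant bdd), (trace_vector phi), pi; split.
- exact: Wtr.
- exact: trace_vector_state.
- exact: star_repS.
- suff piW u : right_commutant bdd (pi u) by move=> _ [u _ <-].
  have [pi1 piL piM _] := piR.
  apply: (@game_alg_ind R X Y A B [set u | right_commutant bdd (pi u)]).
  + split=> /=; first by rewrite pi1.
      by move=> c v w vW wW; rewrite piL//; apply: WL.
    by move=> v w vW wW; rewrite piM//; apply: WM.
  + by move=> x a; rewrite /= E1; apply: left_op_commutant.
  + move=> y b; rewrite /= E2 /point_pvm; case: ifP => // _.
    by move=> v; rewrite mul0r mulr0.
- apply: ideal_gen_kill => //; first exact: subalgebra_gen_subalgebra.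
    move=> _ [x [y [a [b [_ ->]]]]].
    have D1sub : subalgebra D1 := subalgebra_gen_subalgebra _.
    have [_ _ D1M] := D1sub; apply: D1M; first exact: game_alg1_e1.
    by apply: subalgebra_sum => // a'; apply: game_alg1_e1.
  move=> _ [x [y [a [b [xyab ->]]]]]; have [_ _ piM _] := piR.
  have null x' a' y' b' : ~~ lam x' y' a' b' ->
      embed (gns_dot phi) (smul S (p x' a') (q y' b')) = 0.
    move=> x'y'; apply: projection_product_null; rewrite ?padj ?qadj//.
    - by rewrite pp eqxx.
    - by rewrite qq eqxx.
    - exact: pq0.
  have fq : embed (gns_dot phi) (\sum_(a' | lam (eta y) y a' b) p (eta y) a') =
      embed (gns_dot phi) (q y b).
    apply: (@marginal R U S A B _ _ _ _ (fun a' b' => lam (eta y) y a' b')).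
    + exact: embedD.
    + exact: p1.
    + exact: q1.
    + by move=> a' b'; apply: null.
    + by move=> a' b' b''; apply: lam_mirror.2.
  have fE : pi (mirror_f R lam eta y b) =
      left_op bdd (\sum_(a' | lam (eta y) y a' b) p (eta y) a').
    rewrite left_op_sum.
    have piS := star_rep_sum subalgebraT piR (fun a' => lam (eta y) y a' b)
      (F := e1 (eta y)) (fun _ => I).
    apply: etrans piS _; apply: eq_bigr => a' _; exact: E1.
  apply: etrans (piM _ _ I I) _; apply: etrans (f_equal2 *%R (E1 x a) fE) _.
  rewrite -left_opM; apply: left_op_null.
  apply: etrans (esym (left_op_embed bdd _ _)) _.
  apply: etrans (congr1 (left_op bdd (p x a)) fq) _.
  apply: etrans (left_op_embed bdd _ _) _.
  exact: null.
Qed.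

Lemma mirror_trace_model2 : mirror_trace -> tracial_model D2 (mir2 lam xi).
Proof.
move=> [phi [p [q [p_pvm q_pvm pq0]]]].
have bdd := game_mul_bounded phi; have /card_gt0P[a0 _] := A_gt0.
have [pp p1 padj] := p_pvm; have [qq q1 qadj] := q_pvm.
have L1 := point_pvmP (H := completion (gns_dot phi)) (I := X) a0.
have L2 := left_op_pvm bdd q_pvm.
have L12 (x : X) a y b : point_pvm a0 x a * left_op bdd (q y b) =
    left_op bdd (q y b) * point_pvm a0 x a by rewrite point_pvm_comm.
have adj2 y b : is_adjoint (left_op bdd (q y b)) (left_op bdd (q y b)).
  by rewrite -{2}[q y b]qadj; apply: left_op_adjoint.
have piR := game_lift_rep L1 L2 L12 (point_pvm_adjoint a0) adj2.
have E1 := game_lift_e1 L1 L2 L12; have E2 := game_lift_e2 L1 L2 L12.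
set pi := game_lift _ _ in piR E1 E2.
have Wtr := right_commutant_tracial bdd.
have [[W1 WL WM _ _] _ _ _ _] := Wtr.
exists (completion (gns_dot phi)), (right_commutant bdd), (trace_vector phi), pi; split.
- exact: Wtr.
- exact: trace_vector_state.
- exact: star_repS.
- suff piW u : right_commutant bdd (pi u) by move=> _ [u _ <-].
  have [pi1 piL piM _] := piR.
  apply: (@game_alg_ind R X Y A B [set u | right_commutant bdd (pi u)]).
  + split=> /=; first by rewrite pi1.
      by move=> c v w vW wW; rewrite piL//; apply: WL.
    by move=> v w vW wW; rewrite piM//; apply: WM.
  + move=> x a; rewrite /= E1 /point_pvm; case: ifP => // _.
    by move=> v; rewrite mul0r mulr0.
  + by move=> y b; rewrite /= E2; apply: left_op_commutant.
- apply: ideal_gen_kill => //; first exact: subalgebra_gen_subalgebra.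
    move=> _ [x [y [a [b [_ ->]]]]].
    have D2sub : subalgebra D2 := subalgebra_gen_subalgebra _.
    have [_ _ D2M] := D2sub; apply: D2M; first exact: game_alg2_e2.
    by apply: subalgebra_sum => // b'; apply: game_alg2_e2.
  move=> _ [x [y [a [b [xyab ->]]]]]; have [_ _ piM _] := piR.
  have null x' a' y' b' : ~~ lam x' y' a' b' ->
      embed (gns_dot phi) (smul S (q y' b') (p x' a')) = 0.
    move=> x'y'; apply: projection_product_null; rewrite ?padj ?qadj//.
    - by rewrite qq eqxx.
    - by rewrite pp eqxx.
    - by apply: etrans (tfun_trace phi _ _) _; apply: pq0.
  have gp : embed (gns_dot phi) (\sum_(b' | lam x (xi x) a b') q (xi x) b') =
      embed (gns_dot phi) (p x a).
    apply: (@marginal R U S B A _ _ _ _ (fun b' a' => lam x (xi x) a' b')).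
    + exact: embedD.
    + exact: q1.
    + exact: p1.
    + by move=> b' a'; apply: null.
    + by move=> b' a' a''; apply: lam_mirror.1.
  have gE : pi (mirror_g R lam xi x a) =
      left_op bdd (\sum_(b' | lam x (xi x) a b') q (xi x) b').
    rewrite left_op_sum.
    have piS := star_rep_sum subalgebraT piR (fun b' => lam x (xi x) a b')
      (F := e2 (xi x)) (fun _ => I).
    apply: etrans piS _; apply: eq_bigr => b' _; exact: E2.
  apply: etrans (piM _ _ I I) _; apply: etrans (f_equal2 *%R (E2 y b) gE) _.
  rewrite -left_opM; apply: left_op_null.
  apply: etrans (esym (left_op_embed bdd _ _)) _.
  apply: etrans (congr1 (left_op bdd (q y b)) gp) _.
  apply: etrans (left_op_embed bdd _ _) _.
  exact: null.
Qed.

Lemma commuting_idempotentM (T : pzRingType) (P Q : T) :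
  P * P = P -> Q * Q = Q -> P * Q = Q * P -> (P * Q) * (P * Q) = P * Q.
Proof. by move=> PP QQ PQ; rewrite mulrA -[P * Q * P]mulrA -PQ mulrA PP -mulrA QQ. Qed.

Section Strategies.
Context {H : hilbertType R} (pi : U -> bop H) (psi : H).
Hypotheses (piR : star_rep setT pi) (psi_state : is_state psi).

Lemma bop_sum (J : finType) (P : pred J) (F : J -> bop H) (x : H) :
  (\sum_(j | P j) F j) x = \sum_(j | P j) F j x.
Proof. by elim/big_rec2: _ => // j T y _ <-. Qed.

Let win x y a b : C := expect (pi (e1 x a * e2 y b)) psi.

Lemma win_norm x y a b : win x y a b = `|pi (e1 x a * e2 y b) psi| ^+ 2.
Proof.
have [_ _ piM piA] := piR; rewrite -hdot_norm.
have ss : star (e1 x a * e2 y b) = e1 x a * e2 y b :> U.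
  by rewrite starM star_e1 star_e2 -e12_comm.
have idem1 : pi (e1 x a) * pi (e1 x a) = pi (e1 x a).
  by rewrite -piM// e1_pvm.1 eqxx.
have idem2 : pi (e2 y b) * pi (e2 y b) = pi (e2 y b).
  by rewrite -piM// e2_pvm.1 eqxx.
have comm : pi (e1 x a) * pi (e2 y b) = pi (e2 y b) * pi (e1 x a).
  exact: etrans (esym (piM _ _ I I)) (etrans (congr1 pi (e12_comm x a y b)) (piM _ _ I I)).
have idem : pi (e1 x a * e2 y b) * pi (e1 x a * e2 y b) = pi (e1 x a * e2 y b).
  have M : pi (e1 x a * e2 y b) = pi (e1 x a) * pi (e2 y b) := piM _ _ I I.
  by rewrite M; exact: (commuting_idempotentM idem1 idem2 comm).
have /= adjE := piA (e1 x a * e2 y b) I (pi (e1 x a * e2 y b) psi) psi.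
rewrite ss in adjE; apply: etrans adjE; rewrite /win /expect -{1}idem.
by [].
Qed.

Lemma win_ge0 x y a b : 0 <= win x y a b.
Proof. by rewrite win_norm exprn_ge0. Qed.

Lemma expect_sum (J : finType) (P : pred J) (F : J -> bop H) :
  expect (\sum_(j | P j) F j) psi = \sum_(j | P j) expect (F j) psi.
Proof. by rewrite /expect bop_sum linear_sumlz. Qed.

Lemma expect_total (P : A -> bop H) (Q : B -> bop H) :
  \sum_a P a = 1 -> \sum_b Q b = 1 ->
  \sum_a \sum_b expect (P a * Q b) psi = 1.
Proof.
move=> P1 Q1; under eq_bigr do rewrite -expect_sum -mulr_sumr Q1 mulr1.
by rewrite -expect_sum P1 expect1.
Qed.

Lemma win_total x y : \sum_a \sum_b win x y a b = 1.
Proof.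
have [_ _ piM _] := piR.
have [_ P1] := star_rep_pvm subalgebraT piR (fun _ _ => I) (@e1_star_pvm R X Y A B).
have [_ Q1] := star_rep_pvm subalgebraT piR (fun _ _ => I) (@e2_star_pvm R X Y A B).
rewrite -(expect_total (P1 x) (Q1 y)); apply: eq_bigr => a _; apply: eq_bigr => b _.
exact: (congr1 (expect ^~ psi) (piM _ _ I I)).
Qed.

Lemma expect_game_poly : expect (pi (game_poly R lam)) psi =
  (#|X|%:R * #|Y|%:R)^-1 *
    (\sum_x \sum_y \sum_a \sum_b (lam x y a b)%:R * win x y a b).
Proof.
have piS (J : finType) (F : J -> U) : expect (pi (\sum_j F j)) psi =
    \sum_j expect (pi (F j)) psi.
  rewrite -expect_sum; congr (expect _ psi).
  exact: (star_rep_sum subalgebraT piR xpredT (fun _ => I)).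
have piZ (c : C) u : expect (pi (c *: u)) psi = c * expect (pi u) psi.
  have [_ piL _ _] := piR.
  rewrite -[c *: u]addr0 piL// (star_rep0 subalgebraT piR) addr0.
  by rewrite /expect linearZl.
rewrite /game_poly piZ; congr (_ * _).
apply: etrans (piS _ _) _; apply: eq_bigr => x _.
apply: etrans (piS _ _) _; apply: eq_bigr => y _.
apply: etrans (piS _ _) _; apply: eq_bigr => a _.
apply: etrans (piS _ _) _; apply: eq_bigr => b _.
exact: piZ.
Qed.

Lemma perfect_strategyP : expect (pi (game_poly R lam)) psi = 1 <->
  forall x y a b, ~~ lam x y a b -> pi (e1 x a * e2 y b) psi = 0.
Proof.
have XY0 : #|X|%:R * #|Y|%:R != 0 :> C by rewrite mulf_neq0 ?pnatr_eq0 -?lt0n.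
have total : \sum_x \sum_y \sum_a \sum_b win x y a b = #|X|%:R * #|Y|%:R.
  under eq_bigr do under eq_bigr do rewrite win_total.
  by rewrite !sumr_const -mulrnA mulnC natrM.
have loss : \sum_x \sum_y \sum_a \sum_b (lam x y a b)%:R * win x y a b +
    \sum_x \sum_y \sum_a \sum_b (~~ lam x y a b)%:R * win x y a b =
    #|X|%:R * #|Y|%:R.
  rewrite -total -big_split /=; apply: eq_bigr => x _.
  rewrite -big_split /=; apply: eq_bigr => y _; rewrite -big_split /=.
  apply: eq_bigr => a _; rewrite -big_split /=; apply: eq_bigr => b _.
  by case: (lam x y a b); rewrite mul1r mul0r ?addr0 ?add0r.
have loss_ge0 x y a b : 0 <= (~~ lam x y a b)%:R * win x y a b.
  by rewrite mulr_ge0 ?win_ge0.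
rewrite expect_game_poly; split=> [win1 x y a b xyab|lose0].
  have : \sum_x \sum_y \sum_a \sum_b (~~ lam x y a b)%:R * win x y a b = 0.
    move: loss; rewrite -{1}[\sum_x _](mulVKf XY0) win1 mulr1.
    by rewrite -[RHS]addr0 => /addrI.
  move=> /psumr_eq0P => /(_ (fun x _ => sumr_ge0 _ (fun y _ => sumr_ge0 _
    (fun a _ => sumr_ge0 _ (fun b _ => loss_ge0 x y a b))))) /(_ x isT).
  move=> /psumr_eq0P => /(_ (fun y _ => sumr_ge0 _
    (fun a _ => sumr_ge0 _ (fun b _ => loss_ge0 x y a b)))) /(_ y isT).
  move=> /psumr_eq0P => /(_ (fun a _ => sumr_ge0 _
    (fun b _ => loss_ge0 x y a b))) /(_ a isT).
  move=> /psumr_eq0P => /(_ (fun b _ => loss_ge0 x y a b)) /(_ b isT).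
  rewrite xyab mul1r win_norm => /eqP; rewrite expf_eq0 /= => /eqP.
  exact: normr0_eq0.
move: loss; rewrite [X in _ + X]big1 ?addr0 => [->|x _]; first exact: mulVf.
apply: big1 => y _; apply: big1 => a _; apply: big1 => b _.
have [_|xyab] := boolP (lam x y a b); first by rewrite mul0r.
by rewrite mul1r win_norm (lose0 _ _ _ _ xyab) normr0 expr0n.
Qed.

Section NullStrategy.
Hypothesis null : forall x y a b, ~~ lam x y a b -> pi (e1 x a * e2 y b) psi = 0.

Let piM u v : pi (u * v) = pi u * pi v.
Proof. by have [_ _ M _] := piR; apply: M. Qed.

Let piadj u : is_adjoint (pi u) (pi (star u)).
Proof. by have [_ _ _ M] := piR; apply: M. Qed.

Let evalD u v : pi (u + v) psi = pi u psi + pi v psi.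
Proof. by rewrite (star_repD piR I I). Qed.

Lemma mirror_f_vector y b : pi (mirror_f R lam eta y b) psi = pi (e2 y b) psi.
Proof.
apply: (@marginal R U S A B _ (fun u => pi u psi) (e1 (eta y)) (e2 y)
  (fun a' b' => lam (eta y) y a' b')).
- exact: evalD.
- exact: e1_pvm.2.
- exact: e2_pvm.2.
- by move=> a' b'; apply: null.
- by move=> a' b' b''; apply: lam_mirror.2.
Qed.

Lemma mirror_g_vector x a : pi (mirror_g R lam xi x a) psi = pi (e1 x a) psi.
Proof.
apply: (@marginal R U S B A _ (fun u => pi u psi) (e2 (xi x)) (e1 x)
  (fun b' a' => lam x (xi x) a' b')).
- exact: evalD.
- exact: e2_pvm.2.
- exact: e1_pvm.2.
- move=> b' a' /null; apply: etrans.
  exact: (congr1 (fun u => pi u psi) (esym (e12_comm x a' (xi x) b'))).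
- by move=> b' a' a''; apply: lam_mirror.1.
Qed.

Lemma game_alg1_comm u y b : D1 u -> pi u * pi (e2 y b) = pi (e2 y b) * pi u.
Proof.
have [pi1 piL _ _] := piR.
move: u; apply: smallest_sub; last first.
  move=> _ [x [a ->]].
  exact: etrans (esym (piM _ _)) (etrans (congr1 pi (e12_comm x a y b)) (piM _ _)).
split=> /=.
- by rewrite pi1 mul1r mulr1.
- move=> c u v uE vE.
  by rewrite piL// mulrDl mulrDr -bop_scalerAl -bop_scalerAr uE vE.
- by move=> u v uE vE; rewrite piM -mulrA vE !mulrA uE.
Qed.

Lemma mirror_g_comm u x a : D1 u ->
  pi u * pi (mirror_g R lam xi x a) = pi (mirror_g R lam xi x a) * pi u.
Proof.
move=> uD.
have -> : pi (mirror_g R lam xi x a) = \sum_(b | lam x (xi x) a b) pi (e2 (xi x) b).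
  exact: (star_rep_sum subalgebraT piR _ (fun _ => I)).
by rewrite mulr_sumr mulr_suml; apply: eq_bigr => b _; apply: game_alg1_comm.
Qed.

(* On [psi] a generator of U(1) acts as an element of U(2), which commutes with
   U(1). *)
Lemma strategy_trace u v : D1 u -> D1 v ->
  expect (pi u * pi v) psi = expect (pi v * pi u) psi.
Proof.
have D1sub : subalgebra D1 := subalgebra_gen_subalgebra _.
have [D1_1 D1L D1M] := D1sub; have [pi1 piL _ _] := piR.
have expL (c : C) (T T' : bop H) : expect (c *: T + T') psi = c * expect T psi + expect T' psi.
  by apply: (@expect_linear _ _ psi setT).
have : D1 `<=` [set w | D1 w /\ forall z, D1 z ->
    expect (pi z * pi w) psi = expect (pi w * pi z) psi].
  apply: smallest_sub => [|_ [x [a ->]]]; last first.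
    split=> [|z zD]; first exact: game_alg1_e1.
    have selfadj_g T : hdot (pi (mirror_g R lam xi x a) T) psi =
        hdot T (pi (mirror_g R lam xi x a) psi).
      have [_ _ gadj] := mirror_g_pvm.
      exact: etrans (piadj _ T psi) (congr1 (fun u => hdot T (pi u psi)) (gadj x a)).
    have selfadj_e T : hdot (pi (e1 x a) T) psi = hdot T (pi (e1 x a) psi).
      exact: etrans (piadj _ T psi) (congr1 (fun u => hdot T (pi u psi)) (@star_e1 C X Y A B x a)).
    have comm : hdot (pi z (pi (mirror_g R lam xi x a) psi)) psi =
        hdot (pi (mirror_g R lam xi x a) (pi z psi)) psi.
      exact: (congr1 (fun T : bop H => hdot (T psi) psi) (mirror_g_comm x a zD)).
    rewrite -[LHS]/(hdot (pi z (pi (e1 x a) psi)) psi) -(mirror_g_vector x a) comm.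
    rewrite selfadj_g mirror_g_vector -selfadj_e.
    by [].
  split=> /=.
  - by split=> // z _; rewrite pi1 mulr1 mul1r.
  - move=> c w w' [wD wE] [w'D w'E]; split=> [|z zD]; first exact: D1L.
    rewrite piL// mulrDl mulrDr -bop_scalerAl -bop_scalerAr.
    by rewrite !expL wE// w'E.
  - move=> w w' [wD wE] [w'D w'E]; split=> [|z zD]; first exact: D1M.
    rewrite piM mulrA -piM w'E; last exact: D1M.
    rewrite piM mulrA -piM wE; last exact: D1M.
    by rewrite piM mulrA.
by move=> D1E uD /D1E[_]; apply.
Qed.

Lemma strategy_mirror_trace : mirror_trace.
Proof.
apply: (@mirror_trace1 H (pi @` D1) (fun T => expect T psi) pi) => //.
- exact: star_repS.
- exact: expect_linear.
- by move=> _ _ [u uD <-] [v vD <-]; apply: strategy_trace.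
- exact: expect_positive.
- exact: expect1.
- move=> x y a b xyab.
  apply: etrans (congr1 (expect ^~ psi) (piM _ _)) _.
  apply: etrans (congr1 (fun t => hdot (pi (e1 x a) t) psi) (mirror_f_vector y b)) _.
  apply: etrans (congr1 (fun T : bop H => hdot (T psi) psi) (esym (piM _ _))) _.
  by apply: etrans (congr1 (hdot ^~ psi) (null xyab)) _; rewrite linear0l.
Qed.

Lemma left_ideal_null :
  [set pi u psi | u in left_ideal_gen (invalid_set lam)] = [set 0].
Proof.
have pi0 := star_rep0 subalgebraT piR.
have N0 : left_ideal_gen (invalid_set lam) `<=` [set u : U | pi u psi = 0].
  apply: smallest_sub; last by move=> _ [x [y [a [b [xyab ->]]]]]; apply: null.
  split=> /=; first by rewrite pi0.
    by move=> u v u0 v0; rewrite evalD u0 v0 addr0.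
  by move=> u v v0; rewrite piM /= v0 bop0.
apply/seteqP; split=> [_ [u /N0 u0 <-]|_ ->]; first exact: u0.
by exists 0; [move=> J [[J0 _ _] _]|rewrite pi0].
Qed.

End NullStrategy.
End Strategies.

Lemma mirror_trace_strategy : mirror_trace -> perfect_commuting_strategy R lam.
Proof.
move=> [phi [p [q [p_pvm q_pvm pq0]]]].
have bdd := game_mul_bounded phi.
have [pp p1 padj] := p_pvm; have [qq q1 qadj] := q_pvm.
have L1 := left_op_pvm bdd p_pvm; have L2 := right_op_pvm bdd q_pvm.
have L12 x a y b : left_op bdd (p x a) * right_op bdd (q y b) =
    right_op bdd (q y b) * left_op bdd (p x a) by apply: left_right_comm.
have adj1 x a : is_adjoint (left_op bdd (p x a)) (left_op bdd (p x a)).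
  by rewrite -{2}[p x a]padj; apply: left_op_adjoint.
have adj2 y b : is_adjoint (right_op bdd (q y b)) (right_op bdd (q y b)).
  by rewrite -{2}[q y b]qadj; apply: right_op_adjoint.
have piR := game_lift_rep L1 L2 L12 adj1 adj2.
have E1 := game_lift_e1 L1 L2 L12; have E2 := game_lift_e2 L1 L2 L12.
set pi := game_lift _ _ in piR E1 E2.
exists (completion (gns_dot phi)), pi, (trace_vector phi).
split; [exact: piR|exact: trace_vector_state|].
apply/(perfect_strategyP piR (trace_vector_state phi)) => x y a b xyab.
have [_ _ piM _] := piR.
apply: etrans (congr1 (fun T : bop _ => T (trace_vector phi)) (piM _ _ I I)) _.
apply: etrans (congr1 (fun T : bop _ => T (trace_vector phi))
  (f_equal2 *%R (E1 x a) (E2 y b))) _.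
apply: etrans (congr1 (left_op bdd (p x a)) (right_op_embed bdd _ _)) _.
apply: etrans (left_op_embed bdd _ _) _.
rewrite smul1l; apply: projection_product_null; rewrite ?padj ?qadj//.
- by rewrite pp eqxx.
- by rewrite qq eqxx.
- exact: pq0.
Qed.

End Conditions.

Lemma linear_functional0 (R : realType) (X Y A B : finType) (H : hilbertType R)
    (G : set (game_alg R[i] X Y A B)) (pi : game_alg R[i] X Y A B -> bop H)
    (W : set (bop H)) (tau : bop H -> R[i]) :
  star_rep (subalgebra_gen G) pi -> pi @` subalgebra_gen G `<=` W ->
  linear_functional W tau -> tau 0 = 0.
Proof.
move=> piR piW tauL; have Dsub := subalgebra_gen_subalgebra G.
have W0 : W 0.
  by rewrite -(star_rep0 Dsub piR); apply: piW; exists 0 => //; apply: subalgebra0.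
by have := tauL (-1) 0 0 W0 W0; rewrite scaler0 addr0 mulN1r addNr.
Qed.

Theorem theorem3p1 (R : realType) (X Y A B : finType)
    (lam : X -> Y -> A -> B -> bool) (xi : X -> Y) (eta : Y -> X)
    (X_gt0 : (0 < #|X|)%N) (Y_gt0 : (0 < #|Y|)%N)
    (A_gt0 : (0 < #|A|)%N) (B_gt0 : (0 < #|B|)%N)
    (lam_mirror : mirror_game lam xi eta)
    (lam_regular : regular_game lam xi eta) :
  [<-> perfect_commuting_strategy R lam;

       exists (H : hilbertType R) (pi : game_alg R[i] X Y A B -> bop H)
              (psi : H),
         [/\ star_rep setT pi, is_state psi &
             [set pi u psi | u in left_ideal_gen (invalid_set lam)] = [set 0]];

       exists (H : hilbertType R) (pi : game_alg R[i] X Y A B -> bop H)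
              (psi : H),
         [/\ star_rep game_alg1 pi, tracial_state (pi @` game_alg1) psi &
             [set pi u psi | u in mir1 lam eta] = [set 0]];

       exists (H : hilbertType R) (pi : game_alg R[i] X Y A B -> bop H)
              (phi : H),
         [/\ star_rep game_alg2 pi, tracial_state (pi @` game_alg2) phi &
             [set pi u phi | u in mir2 lam xi] = [set 0]];

       exists (H : hilbertType R) (W : set (bop H)) (tau : bop H -> R[i])
              (pi : game_alg R[i] X Y A B -> bop H),
         [/\ tracial_von_neumann_algebra W tau, star_rep game_alg1 pi,
             pi @` game_alg1 `<=` W & pi @` mir1 lam eta = [set 0]];

       exists (H : hilbertType R) (W : set (bop H)) (tau : bop H -> R[i])
              (pi : game_alg R[i] X Y A B -> bop H),
         [/\ tracial_von_neumann_algebra W tau, star_rep game_alg2 pi,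
             pi @` game_alg2 `<=` W & pi @` mir2 lam xi = [set 0]]].
Proof.
have model1 := @mirror_trace_model1 R X Y A B lam xi eta B_gt0 lam_mirror.
have model2 := @mirror_trace_model2 R X Y A B lam xi eta A_gt0 lam_mirror.
have trace1 := @mirror_trace1 R X Y A B lam xi eta B_gt0 lam_mirror lam_regular.
have trace2 := @mirror_trace2 R X Y A B lam xi eta A_gt0 lam_mirror lam_regular.
have mem_mir1 x y a b : ~~ lam x y a b ->
    @mir1 R X Y A B lam eta (e1 x a * mirror_f R lam eta y b).
  by move=> xyab; apply: sub_gen_smallest; exists x, y, a, b.
have mem_mir2 x y a b : ~~ lam x y a b ->
    @mir2 R X Y A B lam xi (e2 y b * mirror_g R lam xi x a).
  by move=> xyab; apply: sub_gen_smallest; exists x, y, a, b.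
have kill (H : hilbertType R) (pi : game_alg R[i] X Y A B -> bop H) J u :
    pi @` J = [set 0] -> J u -> pi u = 0.
  move=> J0 Ju; have : (pi @` J) (pi u) by exists u.
  by rewrite J0.
have killv (H : hilbertType R) (pi : game_alg R[i] X Y A B -> bop H) (psi : H) J u :
    [set pi u psi | u in J] = [set 0] -> J u -> pi u psi = 0.
  move=> J0 Ju; have : [set pi u psi | u in J] (pi u psi) by exists u.
  by rewrite J0.
have image_tracial (H : hilbertType R) (W : set (bop H)) (psi : H) D
    (pi : game_alg R[i] X Y A B -> bop H) :
    tracial_von_neumann_algebra W (fun T => expect T psi) -> is_state psi ->
    pi @` D `<=` W -> tracial_state (pi @` D) psi.
  by move=> [_ _ Wtr _ _] st piW; split=> // T T' /piW WT /piW WT'; apply: Wtr.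
have image_null (H : hilbertType R) (pi : game_alg R[i] X Y A B -> bop H) (psi : H) J :
    pi @` J = [set 0] -> [set pi u psi | u in J] = [set 0].
  move=> J0; apply/seteqP; split=> [_ [u Ju <-]|_ ->].
    by rewrite /= (kill _ _ _ _ J0 Ju).
  have [u Ju u0] : (pi @` J) 0 by rewrite J0.
  by exists u => //; rewrite u0.
tfae.
- move=> [H [pi [psi [piR st win]]]]; exists H, pi, psi; split=> //.
  by apply: left_ideal_null => //; apply/(perfect_strategyP lam X_gt0 Y_gt0 piR st).
- move=> [H [pi [psi [piR st N0]]]].
  have trace : @mirror_trace R X Y A B lam.
    apply: (strategy_mirror_trace B_gt0 lam_mirror lam_regular piR st) => x y a b xyab.
    by apply: (killv _ _ _ _ _ N0); apply: sub_gen_smallest; exists x, y, a, b.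
  have [H' [W' [psi' [pi' [Wtr st' pi'R pi'W J0']]]]] := model1 trace.
  by exists H', pi', psi'; split; [|apply: image_tracial pi'W|apply: image_null].
- move=> [H [pi [psi [piR [st ptr] J0]]]].
  have trace : @mirror_trace R X Y A B lam.
    apply: (trace1 H (pi @` game_alg1) (fun T => expect T psi) pi piR) => //.
    + exact: expect_linear.
    + exact: expect_positive.
    + exact: expect1.
    + move=> x y a b /mem_mir1 /(killv _ _ _ _ _ J0).
      by rewrite /expect => ->; rewrite linear0l.
  have [H' [W' [psi' [pi' [Wtr st' pi'R pi'W J0']]]]] := model2 trace.
  by exists H', pi', psi'; split; [|apply: image_tracial pi'W|apply: image_null].
- move=> [H [pi [psi [piR [st ptr] J0]]]].
  have trace : @mirror_trace R X Y A B lam.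
    apply: (trace2 H (pi @` game_alg2) (fun T => expect T psi) pi piR) => //.
    + exact: expect_linear.
    + exact: expect_positive.
    + exact: expect1.
    + move=> x y a b /mem_mir2 /(killv _ _ _ _ _ J0).
      by rewrite /expect => ->; rewrite linear0l.
  have [H' [W' [psi' [pi' [Wtr st' pi'R pi'W J0']]]]] := model1 trace.
  by exists H', W', (fun T => expect T psi'), pi'.
- move=> [H [W [tau [pi [[_ tauL tauT tauP tau1] piR piW J0]]]]].
  have trace : @mirror_trace R X Y A B lam.
    apply: (trace1 H W tau pi piR) => // x y a b /mem_mir1 /(kill _ _ _ _ J0) ->.
    exact: linear_functional0 piR piW tauL.
  have [H' [W' [psi' [pi' [Wtr st' pi'R pi'W J0']]]]] := model2 trace.
  by exists H', W', (fun T => expect T psi'), pi'.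
- move=> [H [W [tau [pi [[_ tauL tauT tauP tau1] piR piW J0]]]]].
  apply: (mirror_trace_strategy X_gt0 Y_gt0).
  apply: (trace2 H W tau pi piR) => // x y a b /mem_mir2 /(kill _ _ _ _ J0) ->.
  exact: linear_functional0 piR piW tauL.
Qed.
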